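(* Let $\phi=\tilde p/p$ satisfy (A1). Then there is at most one exceptional value $\mu_0\in\mathbb{T}$ such that for every pair of distinct $\lambda,\mu\in\mathbb{T}$, both different from $\mu_0$, the $z_1$-contact order of $\phi$ at $(1,1)$ equals the $z_1$-order of contact between the unimodular level curves $\mathcal{L}_\lambda(\phi)$ and $\mathcal{L}_\mu(\phi)$ at $(1,1)$.
   Context: $\mathbb{D}$ is the open unit disk, $\mathbb{T}$ the unit circle, $\Pi$ the open upper half-plane, $\beta(w)=\frac{1+iw}{1-iw}$ (a conformal map $\Pi\to\mathbb{D}$), $\beta^{-1}(z)=i\frac{1-z}{1+z}$. For a polynomial $p\in\mathbb{C}[z_1,z_2]$ of bidegree $(m,n)$, its reflection is $\tilde p(z_1,z_2)=z_1^mz_2^n\overline{p(1/\bar z_1,1/\bar z_2)}$. A rational inner function (RIF) on $\mathbb{D}^2$ is a rational function that is holomorphic and bounded on $\mathbb{D}^2$ with $|\phi|=1$ a.e. on $\mathbb{T}^2$. We write $f\approx g$ if each of $f,g$ is bounded by a positive constant multiple of the other. (A1): $\phi=\tilde p/p$ is an RIF on $\mathbb{D}^2$, where $p$ has no zeros in $\mathbb{D}^2$ and $p,\tilde p$ have no common factor; $\phi$ has a singularity at $(1,1)$ (i.e. $p(1,1)=0$, hence also $\tilde p(1,1)=0$); and the non-tangential value of $\phi$ at $(1,1)$ is $1$. Branches of the zero set and $z_1$-contact order. Let $q(w_1,w_2)=(1-iw_1)^m(1-iw_2)^n\tilde p(\beta(w_1),\beta(w_2))$. Near $(0,0)$ factor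 $q=\alpha q_1\cdots q_L$ with $\alpha$ a unit and $q_k$ irreducible Weierstrass polynomials in $w_1$ of degree $N_k$; the zero set of $q_k$ is given by a Puiseux series $w_1=\Psi^0_k(w_2^{1/N_k})$ with $\Psi_k^0$ a convergent power series, $\Psi^0_k(0)=0$. Choosing the $N_k$ branches of the root with discontinuity only on $(-\infty,0]$, one gets $L_0=N_1+\dots+N_L$ functions of the form $\psi^0_\ell(z_2)=\beta\big(\Psi^0_k(\beta^{-1}(z_2)^{1/N_k})\big)$; the curves $z_1=\psi^0_\ell(z_2)$, $1\le\ell\le L_0$, are the branches of $\mathcal{Z}_{\tilde p}=\{\tilde p=0\}$ near $(1,1)$. For each branch there is an even number $\mathcal{K}^1_\ell$, its $z_1$-contact order, with $1-|\psi^0_\ell(\zeta_2)|\approx|1-\zeta_2|^{\mathcal{K}^1_\ell}$ for $\zeta_2\in\mathbb{T}$ close to $1$. The $z_1$-contact order of $\phi$ at $(1,1)$ is $\mathcal{K}^1_{(1,1)}=\max_\ell\mathcal{K}^1_\ell$. Level sets and order of contact. For $\mu\in\mathbb{T}$, $\mathcal{L}_\mu(\phi)=\{z\in\mathbb{C}^2:\tilde p(z)=\mu p(z)\}$. Near $(1,1)$, $\mathcal{L}_\mu(\phi)$ is a finite union of graphs $z_1=\psi_j^\mu(z_2)$, $j=1,\dots,L_\mu$ (called its branches), with $\psi^\mu_j$ analytic near $1$ and $\psi^\mu_j(1)=1$, together with, for at most one $\mu\in\mathbb{T}$, possibly the line $\{z_2=1\}$. If $\psi_1,\psi_2$ are analytic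 near $d$ with $\psi_1(d)=\psi_2(d)=c$, the order of contact of $z_1=\psi_1(z_2)$ and $z_1=\psi_2(z_2)$ at $(c,d)$ is the smallest positive integer $K$ with $\psi_1^{(K)}(d)\ne\psi_2^{(K)}(d)$; equivalently $|\psi_1(z_2)-\psi_2(z_2)|\approx|d-z_2|^K$ near $d$. For $\lambda\neq\mu$ in $\mathbb{T}$, the $z_1$-order of contact between $\mathcal{L}_\lambda(\phi)$ and $\mathcal{L}_\mu(\phi)$ at $(1,1)$ is the maximum order of contact at $(1,1)$ between a branch $z_1=\psi^\lambda_i(z_2)$ and a branch $z_1=\psi^\mu_j(z_2)$. *)

(* Defs.v *)
From HB Require Import structures.
From mathcomp Require Import all_boot all_order all_algebra polyXY complex.
From mathcomp Require Import all_classical all_reals all_analysis.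

Set Implicit Arguments.
Unset Strict Implicit.
Unset Printing Implicit Defensive.

Import Order.TTheory GRing.Theory Num.Theory.
Import numFieldNormedType.Exports.

Local Open Scope classical_set_scope.
Local Open Scope ring_scope.

(* The complex numbers, packed as a numClosedFieldType so that
   [numFieldNormedType] provides their topology, which [R[i]] alone lacks.
   Norms take values in [CC R] itself, [x <= y] means that [y - x] is a
   nonnegative real, and the norm on [CC R * CC R] is the maximum norm. *)
Definition CC (R : realType) : numClosedFieldType := R[i].

Section Definitions.
Variable R : realType.
Local Notation C := (CC R).

(* A polynomial in z_1, z_2 is a [{poly {poly C}}] whose outer variable is z_1:
   [p.[z1, z2]] is its value and [p`_i`_j] the coefficient of z_1^i z_2^j. *)
Implicit Types p : {poly {poly C}}.

Definition deg1 p : nat := (size p).-1.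
Definition deg2 p : nat := (sizeY p).-1.

(* z_1^m z_2^n conj(p(1/conj z_1, 1/conj z_2)) for (m, n) the bidegree of p;
   see [horner2_reflection]. *)
Definition reflection p : {poly {poly C}} :=
  \poly_(i < (deg1 p).+1) \poly_(j < (deg2 p).+1)
    (p`_(deg1 p - i)`_(deg2 p - j))^*.

Definition phi p (z : C * C) : C := (reflection p).[z.1, z.2] / p.[z.1, z.2].

Definition bidisk : set (C * C) := [set z | `|z.1| < 1 /\ `|z.2| < 1].

Definition no_common_factor p q : Prop :=
  forall r s t : {poly {poly C}}, p = r * s -> q = r * t -> r \is a GRing.unit.

Definition cis (t : R) : C := Complex (cos t) (sin t).

(* By periodicity, "almost everywhere on the torus" is "for almost every pair
   of arguments in R^2". *)
Definition rational_inner (f : C * C -> C) : Prop :=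
  [/\ exists P Q : {poly {poly C}}, Q != 0 /\
        forall z, Q.[z.1, z.2] != 0 -> f z = P.[z.1, z.2] / Q.[z.1, z.2],
      forall z, bidisk z -> differentiable f z,
      exists M : C, forall z, bidisk z -> `|f z| <= M &
      {ae (@lebesgue_measure R \x @lebesgue_measure R)%E,
        forall t : R * R, `|f (cis t.1, cis t.2)| = 1}].

Definition nontangential_value (f : C * C -> C) (tau : C * C) (v : C) : Prop :=
  forall c : C, 0 < c ->
    f z @[z --> within [set z | bidisk z /\ `|z - tau| <= c * (1 - `|z|)]
                  (nbhs tau)] --> v.

Definition A1 p : Prop :=
  [/\ forall z, bidisk z -> p.[z.1, z.2] != 0,
      no_common_factor p (reflection p),
      rational_inner (phi p),
      p.[1, 1] = 0 &
      nontangential_value (phi p) (1, 1) 1].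

Definition analytic_at (f : C -> C) (d : C) : Prop :=
  exists (a : nat -> C) (r : C), 0 < r /\
    forall h : C, `|h| < r -> series (fun k => a k * h ^+ k) @ \oo --> f (d + h).

Definition holomorphic2_at (f : C * C -> C) (w0 : C * C) : Prop :=
  \forall w \near w0, differentiable f w.

(* Irreducibility in the local ring of germs of holomorphic functions at the
   origin, whose units are the germs with nonzero value there. *)
Definition irreducible_germ (f : C * C -> C) : Prop :=
  [/\ holomorphic2_at f (0, 0),
      f (0, 0) = 0 &
      forall g h : C * C -> C,
        holomorphic2_at g (0, 0) -> holomorphic2_at h (0, 0) ->
        (\forall w \near ((0, 0) : C * C), f w = g w * h w) ->
        g (0, 0) <> 0 \/ h (0, 0) <> 0].

Definition weierstrass_polynomial (N : nat) (f : C * C -> C) : Prop :=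
  exists a : 'I_N -> C -> C,
    (forall i, analytic_at (a i) 0 /\ a i 0 = 0) /\
    forall w, f w = w.1 ^+ N + \sum_(i < N) a i w.2 * w.1 ^+ i.

(* The zero set of [f] near the origin is w_1 = Psi(w_2^{1/N}), all N values of
   the root being allowed. *)
Definition puiseux_parametrization (N : nat) (f : C * C -> C) (Psi : C -> C) :
    Prop :=
  [/\ analytic_at Psi 0,
      Psi 0 = 0 &
      \forall w \near ((0, 0) : C * C),
        f w = 0 <-> exists t : C, t ^+ N = w.2 /\ w.1 = Psi t].

(* The cut ]-oo, 0] is [w <= 0] in the partial order of C; no convention is
   imposed there. *)
Definition root_branches (N : nat) (rho : 'I_N -> C -> C) : Prop :=
  [/\ forall j (w : C), rho j w ^+ N = w,
      forall w : C, w != 0 -> injective (rho ^~ w) &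
      forall j (w : C), ~~ (w <= 0) -> {for w, continuous (rho j)}].

Definition beta (w : C) : C := (1 + 'i * w) / (1 - 'i * w).
Definition beta_inv (z : C) : C := 'i * ((1 - z) / (1 + z)).

Definition pullback p (w : C * C) : C :=
  (1 - 'i * w.1) ^+ deg1 p * (1 - 'i * w.2) ^+ deg2 p *
  (reflection p).[beta w.1, beta w.2].

(* The branches z_1 = psi_{k,j}(z_2) of the zero set of the reflection of p
   near (1, 1): k numbers the irreducible factors of [pullback p] at the origin
   and j the branches of the root of degree [N k]. *)
Definition zero_branches p (L : nat) (N : 'I_L -> nat)
    (psi : forall k, 'I_(N k) -> C -> C) : Prop :=
  exists (alpha : C * C -> C) (q : 'I_L -> C * C -> C) (Psi : 'I_L -> C -> C)
         (rho : forall k, 'I_(N k) -> C -> C),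
    [/\ holomorphic2_at alpha (0, 0) /\ alpha (0, 0) <> 0,
        \forall w \near ((0, 0) : C * C),
          pullback p w = alpha w * \prod_(k < L) q k w,
        forall k, weierstrass_polynomial (N k) (q k) /\ irreducible_germ (q k),
        forall k, puiseux_parametrization (N k) (q k) (Psi k) /\
                  root_branches (rho k) &
        forall k j z2, psi k j z2 = beta (Psi k (rho k j (beta_inv z2)))].

Definition branch_contact_order (psi : C -> C) (K : nat) : Prop :=
  ~~ odd K /\
  exists c1 c2 : C, [/\ 0 < c1, 0 < c2 &
    \forall zeta \near (1 : C), `|zeta| = 1 ->
      c1 * `|1 - zeta| ^+ K <= 1 - `|psi zeta| <= c2 * `|1 - zeta| ^+ K].

Definition z1_contact_order p (K : nat) : Prop :=
  exists (L : nat) (N : 'I_L -> nat) (psi : forall k, 'I_(N k) -> C -> C)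
         (kappa : forall k, 'I_(N k) -> nat),
    [/\ zero_branches p psi,
        forall k j, branch_contact_order (psi k j) (kappa k j) &
        K = (\max_(k < L) \max_(j < N k) kappa k j)%N].

Definition level_set p (mu : C) : set (C * C) :=
  [set z | (reflection p).[z.1, z.2] = mu * p.[z.1, z.2]].

(* [line] tells whether the line z_2 = 1 is part of the level set. *)
Definition level_branches p (mu : C) (L : nat) (psi : 'I_L -> C -> C) : Prop :=
  (forall j, analytic_at (psi j) 1 /\ psi j 1 = 1) /\
  exists line : bool, \forall z \near ((1, 1) : C * C),
    level_set p mu z <-> (exists j, z.1 = psi j z.2) \/ (line /\ z.2 = 1).

Definition order_of_contact (f g : C -> C) (d : C) (K : nat) : Prop :=
  [/\ (0 < K)%N,
      (f^`(K))%classic d <> (g^`(K))%classic d &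
      forall k, (0 < k < K)%N -> (f^`(k))%classic d = (g^`(k))%classic d].

(* The maximal order of contact at (1, 1) between two families of branches. *)
Definition z1_order_of_contact (L L' : nat) (psi : 'I_L -> C -> C)
    (psi' : 'I_L' -> C -> C) (K : nat) : Prop :=
  (exists i j, order_of_contact (psi i) (psi' j) 1 K) /\
  forall i j, exists k, (k <= K)%N /\ order_of_contact (psi i) (psi' j) 1 k.

Lemma horner2E p (a b : C) (m n : nat) :
  (size p <= m)%N -> (sizeY p <= n)%N ->
  p.[a, b] = \sum_(i < m) \sum_(j < n) p`_i`_j * b ^+ j * a ^+ i.
Proof.
move=> sm sn; rewrite (horner_coef_wide _ sm) horner_sum; apply: eq_bigr => i _.
have si : (size (p`_i)%R <= n)%N by exact: leq_trans (max_size_coefXY _ _) sn.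
by rewrite -polyC_exp hornerM hornerC (horner_coef_wide _ si) mulr_suml.
Qed.

Lemma horner2_reflection p (z1 z2 : C) : p != 0 -> z1 != 0 -> z2 != 0 ->
  (reflection p).[z1, z2] =
    z1 ^+ deg1 p * z2 ^+ deg2 p * (p.[1 / z1^*, 1 / z2^*])^*.
Proof.
move=> p0 z10 z20.
have s1 : (size p <= (deg1 p).+1)%N by rewrite /deg1; exact: leqSpred.
have s2 : (sizeY p <= (deg2 p).+1)%N by rewrite /deg2; exact: leqSpred.
have s3 : (size (reflection p) <= (deg1 p).+1)%N by exact: size_poly.
have s4 : (sizeY (reflection p) <= (deg2 p).+1)%N.
  apply/bigmax_leqP => i _; rewrite coef_poly.
  by case: ifP => _; rewrite ?size_poly0 ?size_poly.
rewrite (horner2E _ _ s3 s4) (horner2E _ _ s1 s2) rmorph_sum /= mulr_sumr.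
rewrite (reindex_inj rev_ord_inj) /=; apply: eq_bigr => i _.
rewrite rmorph_sum /= mulr_sumr (reindex_inj rev_ord_inj) /=.
apply: eq_bigr => j _.
have lei : (i <= deg1 p)%N by rewrite -ltnS.
have lej : (j <= deg2 p)%N by rewrite -ltnS.
rewrite !subSS coef_poly ltnS leq_subr coef_poly ltnS leq_subr !subKn //.
rewrite !rmorphM !rmorphXn !rmorphM /= !fmorphV /= rmorph1 !conjCK.
have -> : z1 ^+ deg1 p = z1 ^+ (deg1 p - i) * z1 ^+ i by rewrite -exprD subnK.
have -> : z2 ^+ deg2 p = z2 ^+ (deg2 p - j) * z2 ^+ j by rewrite -exprD subnK.
rewrite !mul1r !exprVn.
have zi : z1 ^+ i != 0 by rewrite expf_neq0.
have zj : z2 ^+ j != 0 by rewrite expf_neq0.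
rewrite [RHS]mulrC (mulrACA (z1 ^+ _)) [_ * (z1 ^+ i * _)]mulrC !mulrA.
by rewrite !divfK // mulrAC.
Qed.

End Definitions.

(* Main.v *)
Require Import Defs.
From HB Require Import structures.
From mathcomp Require Import all_boot all_order all_algebra polyXY complex.
From mathcomp Require Import all_classical all_reals all_analysis.
From mathcomp Require Import lra ring.
Import Order.TTheory GRing.Theory Num.Theory.
Import numFieldNormedType.Exports.
Local Open Scope classical_set_scope.
Local Open Scope ring_scope.

(* For zeta on the circle, close to 1 and different from it, let P and Q be the
   slices of p and of its reflection at z_2 = zeta, and put h = |1 - zeta|^K.
   Then |P| = |Q| on the circle. The zeros of Q near 1 stay at distance at least
   c h from the circle, and one of them, a, at distance comparable to h.

   Everything rests on one remark: a polynomial of bounded degree without zeros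
   in D(a, rho) is nearly constant on D(a, delta rho) for small delta.

   Contact at most K: a level curve point z is unimodular (P has no zero in the
   disk, by Hurwitz), so P and Q have no zeros within a multiple of h from z, and
   Q/P cannot pass from lam to mu within a small multiple of h.

   Contact at least K: if neither Q = lam P nor Q = mu P had a solution in
   D(a, M h) for a large M, then both polynomials Q - lam P and Q - mu P, hence P
   and Q, would be nearly constant around a; as Q(a) = 0 this contradicts
   |Q| = |P| at a/|a|. So of two levels at least one comes within M h of a, and
   all levels but possibly one do so along a common sequence of zeta's. *)

Set Implicit Arguments.
Unset Strict Implicit.

(** * Modulus and neighbourhoods in the complex plane *)

(** The norm of [CC R] lives in [CC R], whose order is partial; its real part is the same number in
    the totally ordered field [R], where [lra] applies. *)
Definition cabs (R : realType) (z : CC R) : R := complex.Re `|z|.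

Section Modulus.
Variable R : realType.
Local Notation C := (CC R).
Implicit Types (z w : C) (x y : R).

Definition toC x : C := Complex x 0.

Lemma cabsE z : `|z| = toC (cabs z).
Proof. by rewrite /cabs /toC; apply/esym/RRe_real/normr_real. Qed.

Lemma le_toC x y : (toC x <= toC y) = (x <= y).
Proof. exact: lecR. Qed.
Lemma lt_toC x y : (toC x < toC y) = (x < y).
Proof. exact: ltcR. Qed.
Lemma toC_inj : injective toC.
Proof. by move=> x y []. Qed.
Lemma toCD x y : toC (x + y) = toC x + toC y.
Proof. exact: (rmorphD (real_complex R)). Qed.
Lemma toCM x y : toC (x * y) = toC x * toC y.
Proof. exact: (rmorphM (real_complex R)). Qed.
Lemma toCB x y : toC (x - y) = toC x - toC y.
Proof. exact: (rmorphB (real_complex R)). Qed.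
Lemma toCX x n : toC (x ^+ n) = toC x ^+ n.
Proof. exact: (rmorphXn (real_complex R)). Qed.
Lemma toC0 : toC 0 = 0. Proof. by []. Qed.
Lemma toC1 : toC 1 = 1. Proof. by []. Qed.

Lemma gt0_toC (c : C) : 0 < c -> exists2 x, 0 < x & c = toC x.
Proof.
move=> c0; exists (complex.Re c); last first.
  by rewrite /toC; apply/esym/RRe_real/ger0_real/ltW.
by move: c0; rewrite ltcE => /andP[].
Qed.

Lemma cabs_ge0 z : 0 <= cabs z.
Proof.
have : toC 0 <= toC (cabs z) by rewrite -cabsE; exact: normr_ge0.
by rewrite le_toC.
Qed.
Lemma cabs0 : cabs (0 : C) = 0. Proof. by apply: toC_inj; rewrite -cabsE normr0. Qed.
Lemma cabs1 : cabs (1 : C) = 1. Proof. by apply: toC_inj; rewrite -cabsE normr1. Qed.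
Lemma cabs_eq0 z : (cabs z == 0) = (z == 0).
Proof. by rewrite -[RHS]normr_eq0 cabsE -(inj_eq toC_inj). Qed.
Lemma cabs_gt0 z : (0 < cabs z) = (z != 0).
Proof. by rewrite lt0r cabs_eq0 cabs_ge0 andbT. Qed.
Lemma cabsM z w : cabs (z * w) = cabs z * cabs w.
Proof. by apply: toC_inj; rewrite toCM -!cabsE normrM. Qed.
Lemma cabsV z : cabs z^-1 = (cabs z)^-1.
Proof.
apply: toC_inj; rewrite -cabsE normfV cabsE.
exact/esym/(fmorphV (real_complex R)).
Qed.
Lemma cabsX z n : cabs (z ^+ n) = cabs z ^+ n.
Proof. by apply: toC_inj; rewrite toCX -!cabsE normrX. Qed.
Lemma cabsN z : cabs (- z) = cabs z.
Proof. by apply: toC_inj; rewrite -!cabsE normrN. Qed.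
Lemma cabsBC z w : cabs (z - w) = cabs (w - z).
Proof. by rewrite -cabsN opprB. Qed.
Lemma cabsD z w : cabs (z + w) <= cabs z + cabs w.
Proof. by rewrite -le_toC toCD -!cabsE ler_normD. Qed.
Lemma cabsB z w : cabs (z - w) <= cabs z + cabs w.
Proof. by rewrite -(cabsN w) cabsD. Qed.
Lemma cabs_tri u z w : cabs (z - w) <= cabs (z - u) + cabs (u - w).
Proof. by have := cabsD (z - u) (u - w); rewrite addrA subrK. Qed.
Lemma cabsD_ge z w : cabs z - cabs w <= cabs (z + w).
Proof. by rewrite lerBlDr; have := cabsB (z + w) w; rewrite addrK. Qed.
Lemma cabs_conj z : cabs z^* = cabs z.
Proof. by apply: toC_inj; rewrite -!cabsE norm_conjC. Qed.
Lemma cabs_toC x : 0 <= x -> cabs (toC x) = x.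
Proof.
by move=> x0; apply: toC_inj; rewrite -cabsE ger0_norm // -toC0 le_toC.
Qed.
Lemma cabs_i : cabs ('i : C) = 1.
Proof. by apply: toC_inj; rewrite -cabsE normCi. Qed.
Lemma cabs_sum I (s : seq I) (F : I -> C) :
  cabs (\sum_(i <- s) F i) <= \sum_(i <- s) cabs (F i).
Proof.
elim/big_ind2 : _ => [|x1 x2 y1 y2 h1 h2|//]; first by rewrite cabs0.
exact: le_trans (cabsD _ _) (lerD h1 h2).
Qed.
Lemma cabs_prod I (s : seq I) (F : I -> C) :
  cabs (\prod_(i <- s) F i) = \prod_(i <- s) cabs (F i).
Proof.
elim/big_ind2 : _ => [|x1 x2 y1 y2 h1 h2|//]; first exact: cabs1.
by rewrite cabsM h1 h2.
Qed.
Lemma cabs_Re z : `|complex.Re z| <= cabs z.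
Proof. by rewrite -le_toC -cabsE; exact: normc_ge_Re. Qed.
Lemma cabs_Im z : `|complex.Im z| <= cabs z.
Proof.
have := cabs_Re (z * 'i%C); rewrite ReiNIm normrN => h.
apply: le_trans h _; rewrite cabsM.
suff -> : cabs ('i%C : C) = 1 by rewrite mulr1.
apply: toC_inj; rewrite -cabsE normc_def /=.
by rewrite expr0n expr1n add0r sqrtr1.
Qed.
Lemma cabs_ReIm z : cabs z <= `|complex.Re z| + `|complex.Im z|.
Proof.
case: z => a b /=.
have -> : (Complex a b : C) = toC a + Complex 0 b.
  by rewrite /toC; apply/eqP; rewrite eq_complex /= addr0 add0r !eqxx.
apply: le_trans (cabsD _ _) _.
by rewrite /cabs !normc_def /= !expr0n /= add0r addr0 !sqrtr_sqr.
Qed.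

Lemma cabs_natr n : cabs (n%:R : C) = n%:R.
Proof.
rewrite -[RHS](cabs_toC (ler0n R n)); congr cabs.
exact/esym/(rmorph_nat (real_complex R)).
Qed.

Lemma normE1 z : `|z| = 1 <-> cabs z = 1.
Proof. by rewrite cabsE -toC1; split => [/toC_inj|->]. Qed.

Lemma mulCconj z : z * z^* = toC (cabs z ^+ 2).
Proof. by rewrite -normCK cabsE toCX. Qed.
End Modulus.

Section NearBall.
Variable R : realType.
Local Notation C := (CC R).

Lemma near1P (c : C) (P : C -> Prop) :
  (\forall z \near c, P z) -> exists2 e : R, 0 < e & forall z, cabs (c - z) < e -> P z.
Proof.
move=> /nbhs_ballP[e /= /gt0_toC[x x0 ->]] h; exists x => // z cz.
by apply: h; rewrite -ball_normE /ball_ /= cabsE lt_toC.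
Qed.

Lemma near2P (c : C * C) (P : C * C -> Prop) :
  (\forall z \near c, P z) -> exists2 e : R, 0 < e &
    forall z1 z2, cabs (c.1 - z1) < e -> cabs (c.2 - z2) < e -> P (z1, z2).
Proof.
move=> /nbhs_ballP[e /= /gt0_toC[x x0 ->]] h; exists x => // z1 z2 cz1 cz2.
by apply: h; split; rewrite -ball_normE /ball_ /= cabsE lt_toC.
Qed.

Lemma cabs_near (c : C) (P : C -> Prop) (e : R) : 0 < e ->
  (forall z, cabs (c - z) < e -> P z) -> \forall z \near c, P z.
Proof.
move=> e0 h; apply/nbhs_ballP; exists (toC e); first by rewrite /= -toC0 lt_toC.
by move=> z; rewrite -ball_normE /ball_ /= cabsE lt_toC => /h.
Qed.

(** A property inherited by smaller thresholds holds at the minimum of finitely many. The threshold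
    may act as a radius and as a lower constant at once. *)
Lemma uniform_threshold (I : finType) (P : I -> R -> Prop) :
  (forall i a b, 0 < a <= b -> P i b -> P i a) ->
  (forall i, exists2 e, 0 < e & P i e) ->
  exists2 e, 0 < e & forall i, P i e.
Proof.
move=> mono ex.
suff [e e0 he] : exists2 e, 0 < e & forall i, i \in enum I -> P i e.
  by exists e => // i; apply: he; rewrite mem_enum.
elim: (enum I) => [|i s [e e0 he]]; first by exists 1.
have [e' e'0 he'] := ex i; exists (Num.min e e'); first by rewrite lt_min e0.
move=> j; rewrite inE => /orP[/eqP->|js].
  by apply: mono he'; rewrite lt_min e0 e'0 ge_min lexx orbT.
by apply: mono (he _ js); rewrite lt_min e0 e'0 ge_min lexx.
Qed.
End NearBall.

(** * Polynomials in one variable and slices *)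

Section OneVariable.
Variable R : realType.
Local Notation C := (CC R).
Implicit Types (f P Q : {poly C}) (r : seq C) (a b z w : C).

Lemma poly_roots f : exists r,
  [/\ forall z, f.[z] = lead_coef f * \prod_(b <- r) (z - b),
      f != 0 -> size f = (size r).+1 &
      forall b, b \in r -> f.[b] = 0].
Proof.
have [r fE] := closed_field_poly_normal f.
have ev z : f.[z] = lead_coef f * \prod_(b <- r) (z - b).
  rewrite {1}fE hornerZ horner_prod; congr (_ * _).
  by apply: eq_bigr => b _; rewrite !hornerE.
exists r; split=> [//|f0|b br].
  by rewrite {1}fE size_scale ?lead_coef_eq0 // size_prod_XsubC.
rewrite ev; apply/eqP; rewrite mulf_eq0 prodf_seq_eq0; apply/orP; right.
by apply/hasP; exists b; rewrite //= subrr eqxx.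
Qed.

Lemma poly_lipschitz f x : exists2 L : R, 0 <= L &
  forall y, cabs (x - y) <= 1 -> cabs (f.[x] - f.[y]) <= L * cabs (x - y).
Proof.
elim/poly_ind: f => [|f c [L L0 IH]].
  by exists 0 => // y _; rewrite !horner0 subrr cabs0 mul0r.
exists (L * (cabs x + 1) + cabs f.[x]) => [|y xy].
  by rewrite addr_ge0 ?mulr_ge0 ?addr_ge0 ?cabs_ge0.
rewrite !hornerE.
have -> : f.[x] * x + c - (f.[y] * y + c) =
  (f.[x] - f.[y]) * y + f.[x] * (x - y) by ring.
apply: le_trans (cabsD _ _) _; rewrite !cabsM mulrDl lerD2r mulrAC.
apply: ler_pM; rewrite ?cabs_ge0 ?IH //.
have := cabs_tri x y 0; rewrite !subr0 cabsBC => h.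
by rewrite addrC; apply: le_trans h _; rewrite lerD2r.
Qed.

Lemma poly_continuous f x (e : R) : 0 < e ->
  exists2 d : R, 0 < d & forall y, cabs (x - y) < d -> cabs (f.[x] - f.[y]) < e.
Proof.
move=> e0; have [L L0 hL] := poly_lipschitz f x.
have L1 : 0 < L + 1 by rewrite ltr_wpDl.
exists (Num.min 1 (e / (L + 1))); first by rewrite lt_min ltr01 divr_gt0.
move=> y; rewrite lt_min => /andP[y1]; rewrite ltr_pdivlMr // => ye.
apply: le_lt_trans (hL _ (ltW y1)) _; apply: le_lt_trans ye.
by rewrite mulrC ler_wpM2l ?cabs_ge0 // lerDl.
Qed.

(** Moving from [a] to [z] changes each factor by a relative error at most [d], so the product of
    [n] factors by at most [(1 + d) ^+ n - 1], which is below [d * (2 ^+ n - 1)] for [d <= 1] by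
    convexity. *)
Lemma prod_sub_near_const r a z (rho d : R) : 0 <= d <= 1 ->
  (forall b, b \in r -> rho <= cabs (a - b)) -> cabs (z - a) <= d * rho ->
  cabs (\prod_(b <- r) (z - b) - \prod_(b <- r) (a - b)) <=
    d * (2 ^+ size r - 1) * cabs (\prod_(b <- r) (a - b)).
Proof.
move=> /andP[d0 d1] + zad; elim: r => [_|b r IH hr].
  by rewrite !big_nil subrr cabs0 expr0 subrr mulr0 mul0r.
have {}IH := IH (fun c cr => hr c (mem_behead (s := b :: r) cr)).
have hb : rho <= cabs (a - b) by apply: hr; rewrite mem_head.
rewrite !big_cons /=; set X := \prod_(_ <- r) (z - _) in IH *.
set Y := \prod_(_ <- r) (a - _) in IH *.
have -> : (z - b) * X - (a - b) * Y =
    (z - a) * (X - Y) + (z - a) * Y + (a - b) * (X - Y) by ring.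
apply: le_trans (cabsD _ _) _; apply: le_trans (lerD (cabsD _ _) (lexx _)) _.
rewrite !cabsM exprS.
have : 1 <= 2 ^+ size r :> R by rewrite exprn_ege1 // ler1n.
move: (2 ^+ _) IH => T.
have := cabs_ge0 (z - a); have := cabs_ge0 (X - Y); have := cabs_ge0 Y.
have := cabs_ge0 (a - b).
move: (cabs (a - b)) hb (cabs (z - a)) zad (cabs (X - Y)) (cabs Y).
move=> v rv u ud s y v0 y0 s0 u0 sdy T1.
have uv : u <= d * v by apply: le_trans ud _; apply: ler_wpM2l.
have us : u * s <= d * v * (1 * ((T - 1) * y)).
  apply: ler_pM => //; apply: le_trans sdy _; rewrite -mulrA ler_wpM2r //.
  by rewrite mulr_ge0 // subr_ge0.
have uy : u * y <= d * v * y by exact: ler_wpM2r.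
have vs : v * s <= v * (d * (T - 1) * y) by exact: ler_wpM2l.
lra.
Qed.

(** The zeros of [f] lie at distance at least [rho] from [a], so its factorization is almost
    constant near [a]. The constant depends only on the degree bound, hence is uniform over
    slices. *)
Lemma near_const m f a z (rho d : R) : (size f <= m.+1)%N -> 0 <= d <= 1 ->
  (forall w, cabs (w - a) < rho -> f.[w] != 0) -> cabs (z - a) <= d * rho ->
  0 < rho ->
  cabs (f.[z] - f.[a]) <= d * 2 ^+ m * cabs f.[a].
Proof.
move=> sf /[dup] d01 /andP[d0 d1] nz za rho0.
have [r [fE sr rt]] := poly_roots f.
have f0 : f != 0.
  apply/eqP => f0; have := nz a; rewrite subrr cabs0 => /(_ rho0).
  by rewrite f0 horner0 eqxx.
have lf0 : lead_coef f != 0 by rewrite lead_coef_eq0.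
have hr b : b \in r -> rho <= cabs (a - b).
  move=> br; rewrite leNgt; apply/negP => ab.
  by have := nz b; rewrite cabsBC rt // eqxx => /(_ ab).
have := prod_sub_near_const d01 hr za.
rewrite !fE -mulrBr !cabsM => h.
rewrite mulrCA ler_wpM2l ?cabs_ge0 //; apply: le_trans h _.
rewrite ler_wpM2r ?cabs_ge0 // ler_wpM2l // lerBlDr.
have := sr f0 => sE; rewrite sE ltnS in sf.
apply: (@le_trans _ _ (2 ^+ m)); last by rewrite lerDl.
by rewrite ler_weXn2l // ler1n.
Qed.

Lemma disk_free_roots f : (forall w, cabs w < 1 -> f.[w] != 0) -> exists r,
  [/\ forall z, f.[z] = lead_coef f * \prod_(b <- r) (z - b),
      size f = (size r).+1,
      forall b, b \in r -> 1 <= cabs b &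
      lead_coef f != 0].
Proof.
move=> nz; have [r [fE sr rt]] := poly_roots f.
have f0 : f != 0.
  apply/eqP => f0; have := nz 0; rewrite cabs0 ltr01 => /(_ isT).
  by rewrite f0 horner0 eqxx.
exists r; split; rewrite ?sr ?lead_coef_eq0 // => b br.
by rewrite leNgt; apply/negP => ab; have := nz b ab; rewrite rt // eqxx.
Qed.

(* Harnack's inequality for the modulus of a polynomial without zeros in the
   disk: it survives limits, which is what Hurwitz's theorem needs. *)
Lemma poly_harnack m f z z' (rho : R) : (size f <= m.+1)%N ->
  (forall w, cabs w < 1 -> f.[w] != 0) -> 0 <= rho < 1 ->
  cabs z <= rho -> cabs z' <= 1 ->
  ((1 - rho) / 2) ^+ m * cabs f.[z'] <= cabs f.[z].
Proof.
move=> sf nz /andP[rho0 rho1] zr z1.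
have [r [fE sE hr _]] := disk_free_roots nz.
set k := (1 - rho) / 2.
have k0 : 0 <= k by rewrite /k; lra.
have k1 : k <= 1 by rewrite /k; lra.
rewrite !fE !cabsM !cabs_prod mulrCA ler_wpM2l ?cabs_ge0 //.
rewrite sE ltnS in sf.
apply: (@le_trans _ _ (k ^+ size r * \prod_(b <- r) cabs (z' - b))).
  rewrite ler_wpM2r ?ler_wiXn2l //.
  by elim/big_ind : _ => // [x y|b _]; [exact: mulr_ge0|exact: cabs_ge0].
elim: r hr {fE sE sf} => [_|b r IH hr]; first by rewrite !big_nil expr0 mulr1.
rewrite !big_cons /= exprS mulrACA; apply: ler_pM.
- by rewrite mulr_ge0 ?cabs_ge0.
- rewrite mulr_ge0 ?exprn_ge0 //.
  by elim/big_ind : _ => // [x y|c _]; [exact: mulr_ge0|exact: cabs_ge0].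
(* Factor by factor: [k * |z' - b| <= k * (1 + |b|) <= |b| - rho <= |z - b|], because [|b| >= 1]. *)
- have b1 : 1 <= cabs b by apply: hr; rewrite mem_head.
  have h1 := cabsB z' b; have := cabsD_ge b (- z); rewrite cabsN cabsBC => h2.
  have h3 : k * cabs (z' - b) <= k * (1 + cabs b).
    by rewrite ler_wpM2l //; lra.
  have h4 : k * cabs b = (cabs b - rho * cabs b) / 2 by rewrite /k; lra.
  have h5 : rho * 1 <= rho * cabs b by rewrite ler_wpM2l.
  have h6 : k * (1 + cabs b) <= cabs b - rho.
    apply: (@le_trans _ _ ((1 - rho) * cabs b)); last by lra.
    rewrite mulrDr h4 mulr1 /k.
    have h7 : (1 - rho) * 1 <= (1 - rho) * cabs b by rewrite ler_wpM2l //; lra.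
    lra.
  lra.
- by apply: IH => c cr; apply: hr; rewrite inE cr orbT.
Qed.

(** The difference of the squared moduli is [(1 - |z|^2) * (|b|^2 - 1)], which also settles the
    equality case. *)
Lemma reflect_factor b z : 1 <= cabs b -> cabs z < 1 ->
  cabs (1 - b^* * z) <= cabs (z - b) ?= iff (cabs b == 1).
Proof.
move=> b1 z1.
have E : cabs (z - b) ^+ 2 - cabs (1 - b^* * z) ^+ 2 =
    (1 - cabs z ^+ 2) * (cabs b ^+ 2 - 1).
  apply: (@toC_inj R); rewrite toCM !toCB -!mulCconj !rmorphB !rmorphM /= conjCK.
  by rewrite rmorph1 toC1; ring.
have zz : 0 < 1 - cabs z ^+ 2.
  by rewrite subr_gt0 expr_lt1 ?cabs_ge0.
have bb : 0 <= cabs b ^+ 2 - 1 by rewrite subr_ge0 expr_ge1 ?cabs_ge0.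
split.
  by rewrite -(ler_pXn2r (n := 2)) ?nnegrE ?cabs_ge0 // -subr_ge0 E mulr_ge0 // ltW.
rewrite -(eqrXn2 (n := 2)) ?cabs_ge0 // eq_sym -subr_eq0 E mulf_eq0 gt_eqF //=.
by rewrite subr_eq0 sqrp_eq1 ?cabs_ge0.
Qed.

Lemma reflect_prod r z : (forall b, b \in r -> 1 <= cabs b) -> cabs z < 1 ->
  \prod_(b <- r) cabs (1 - b^* * z) <= \prod_(b <- r) cabs (z - b).
Proof.
move=> hr z1; elim: r hr => [_|b r IH hr]; first by rewrite !big_nil.
rewrite !big_cons ler_pM ?cabs_ge0 //.
- by elim/big_ind : _ => // [x y|c _]; [exact: mulr_ge0|exact: cabs_ge0].
- by apply: (reflect_factor _ z1).1; apply: hr; rewrite mem_head.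
- by apply: IH => c cr; apply: hr; rewrite inE cr orbT.
Qed.

(** The factor of [b0] gives strictness, since the remaining factors [z - b] are nonzero. *)
Lemma reflect_prod_lt r z b0 : (forall b, b \in r -> 1 <= cabs b) -> cabs z < 1 ->
  b0 \in r -> 1 < cabs b0 ->
  \prod_(b <- r) cabs (1 - b^* * z) < \prod_(b <- r) cabs (z - b).
Proof.
move=> hr z1 br b1; rewrite !(perm_big _ (perm_to_rem br)) /= !big_cons.
have hr' b : b \in rem b0 r -> 1 <= cabs b by move=> /mem_rem; exact: hr.
have b0' := ltW b1.
have lt0 : cabs (1 - b0^* * z) < cabs (z - b0).
  by rewrite lt_neqAle (reflect_factor b0' z1).2 (reflect_factor b0' z1).1 gt_eqF.
apply: (@le_lt_trans _ _ (cabs (1 - b0^* * z) * \prod_(b <- rem b0 r) cabs (z - b))).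
  by rewrite ler_wpM2l ?cabs_ge0 ?reflect_prod.
rewrite ltr_pM2r // {lt0}.
rewrite big_seq; elim/big_ind : _ => [//|x y|b /hr' b1'].
  exact: mulr_gt0.
by rewrite cabs_gt0 subr_eq0; apply: contraTneq z1 => ->; rewrite -leNgt.
Qed.

(** The left side is the modulus at [z] of the reflection of [f] in degree [m], which replaces each
    factor [z - b] by [1 - conj(b) z]. A degree below [m] only adds powers of [|z| < 1]. *)
Lemma reflection_lt m f z b0 : (size f <= m.+1)%N ->
  (forall w, cabs w < 1 -> f.[w] != 0) -> f.[b0] = 0 -> 1 < cabs b0 ->
  0 < cabs z < 1 -> cabs z ^+ m * cabs f.[(z^*)^-1] < cabs f.[z].
Proof.
move=> sf nz fb0 b01 /andP[z0 z1].
have [r [fE sE hr lf0]] := disk_free_roots nz.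
have b0r : b0 \in r.
  move/eqP: fb0; rewrite fE mulf_eq0 (negPf lf0) /= prodf_seq_eq0 => /hasP[b br].
  by rewrite /= subr_eq0 => /eqP ->.
have zn0 : z != 0 by rewrite -cabs_gt0.
rewrite sE ltnS in sf.
rewrite !fE !cabsM mulrCA ltr_pM2l ?cabs_gt0 // !cabs_prod.
apply: le_lt_trans (reflect_prod_lt hr z1 b0r b01).
apply: (@le_trans _ _ (cabs z ^+ size r * \prod_(b <- r) cabs ((z^*)^-1 - b))).
  rewrite ler_wpM2r //; last by rewrite ler_wiXn2l ?cabs_ge0 // ltW.
  by elim/big_ind : _ => // [x y|b _]; [exact: mulr_ge0|exact: cabs_ge0].
rewrite le_eqVlt; apply/orP; left; apply/eqP.
elim: r {fE hr b0r sE sf} => [|b r IH]; first by rewrite !big_nil expr0 mulr1.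
rewrite !big_cons exprS mulrACA IH; congr (_ * _).
rewrite -(cabs_conj z) -cabsM mulrBr mulfV ?conjC_eq0 //.
by rewrite -cabs_conj rmorphB rmorphM /= conjCK rmorph1 mulrC.
Qed.

Lemma cabs_conjV z : cabs (z^*)^-1 = (cabs z)^-1.
Proof. by rewrite cabsV cabs_conj. Qed.

Lemma conjVK z : (((z^*)^-1)^*)^-1 = z.
Proof. by rewrite fmorphV /= invrK conjCK. Qed.

(** The zero [a] of [Q] reflects to a zero of [P] outside the closed disk, so [|Q| < |P|] in the
    punctured disk. Reflection reverses the inequality outside, which leaves only the circle. *)
Lemma unimodular_solution m P Q z a : (size P <= m.+1)%N ->
  (forall w, w != 0 -> cabs Q.[w] = cabs w ^+ m * cabs P.[(w^*)^-1]) ->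
  (forall w, cabs w < 1 -> P.[w] != 0) ->
  Q.[a] = 0 -> 0 < cabs a < 1 -> z != 0 -> cabs Q.[z] = cabs P.[z] ->
  cabs z = 1.
Proof.
move=> sP QP nzP Qa /andP[a0 a1] z0 Qz.
have an0 : a != 0 by rewrite -cabs_gt0.
have Pb : P.[(a^*)^-1] = 0.
  move: (QP a an0); rewrite Qa cabs0 => /esym/eqP.
  by rewrite mulf_eq0 expf_eq0 !cabs_eq0 (negPf an0) andbF /= => /eqP.
have b1 : 1 < cabs (a^*)^-1 by rewrite cabs_conjV invf_gt1.
have lt w : 0 < cabs w < 1 -> cabs Q.[w] < cabs P.[w].
  move=> /[dup] /andP[w0 _] w01; rewrite QP; last by rewrite -cabs_gt0.
  exact: reflection_lt sP nzP Pb b1 w01.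
have zp : 0 < cabs z by rewrite cabs_gt0.
case: (ltrgtP (cabs z) 1) => // z1.
  by have := lt z; rewrite zp z1 Qz ltxx => /(_ isT).
have := lt (z^*)^-1; rewrite cabs_conjV invr_gt0 zp invf_lt1 // z1 => /(_ isT).
rewrite QP ?invr_eq0 ?conjC_eq0 // conjVK cabs_conjV -Qz QP // exprVn.
by rewrite mulKf ?ltxx // expf_neq0 // cabs_eq0.
Qed.
End OneVariable.

(** * Slices over the unit circle *)

Section Fiber.
Variable R : realType.
Local Notation C := (CC R).
Implicit Types (p : {poly {poly C}}) (z w : C).

Definition fiber p z2 : {poly C} := map_poly (horner_eval z2) p.

Lemma horner_fiber p z1 z2 : (fiber p z2).[z1] = p.[z1, z2].
Proof.
have := horner_map (horner_eval z2) p z1%:P.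
by rewrite /= /horner_eval hornerC.
Qed.

Lemma size_fiber p z2 : (size (fiber p z2) <= (deg1 p).+1)%N.
Proof. by apply: leq_trans (size_poly _ _) _; rewrite /deg1; exact: leqSpred. Qed.

Lemma size_fiber_reflection p z2 :
  (size (fiber (reflection p) z2) <= (deg1 p).+1)%N.
Proof. by apply: leq_trans (size_poly _ _) _; exact: size_poly. Qed.

Lemma cabs1_neq0 z : cabs z = 1 -> z != 0.
Proof. by move=> z1; rewrite -cabs_gt0 z1. Qed.

Lemma conjV1 z : cabs z = 1 -> (z^*)^-1 = z.
Proof.
move=> z1; have z0 := cabs1_neq0 z1; apply: (mulIf (x := z^*)).
  by rewrite conjC_eq0.
by rewrite mulVf ?conjC_eq0 // mulCconj z1 expr1n.
Qed.

(** A point [z2] of the circle is its own reflection, so the slice of the reflected polynomial is,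
    up to a unimodular factor, the reflection of the slice. *)
Lemma fiber_reflection p z2 w : p != 0 -> cabs z2 = 1 -> w != 0 ->
  cabs (fiber (reflection p) z2).[w] =
    cabs w ^+ deg1 p * cabs (fiber p z2).[(w^*)^-1].
Proof.
move=> p0 z21 w0; rewrite !horner_fiber horner2_reflection //; last exact: cabs1_neq0.
rewrite !cabsM !cabsX cabs_conj z21 expr1n mulr1 !div1r.
by rewrite (conjV1 z21).
Qed.

Lemma fiber_reflection_circle p z2 w : p != 0 -> cabs z2 = 1 -> cabs w = 1 ->
  cabs (fiber (reflection p) z2).[w] = cabs (fiber p z2).[w].
Proof.
move=> p0 z21 w1; rewrite fiber_reflection ?cabs1_neq0 //.
by rewrite w1 expr1n mul1r conjV1.
Qed.

(** Hurwitz's theorem for slices: at [y] in the disk near [z2], Harnack's inequality gives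
    [|p(w, y)| >= k * |p(1, y)|] with [k] independent of [y]; a zero at [(w, z2)] would contradict
    this as [y] tends to [z2]. *)
Lemma fiber_hurwitz p z2 : (forall u : C * C, bidisk u -> p.[u.1, u.2] != 0) ->
  cabs z2 = 1 -> (fiber p z2).[1] != 0 ->
  forall w, cabs w < 1 -> (fiber p z2).[w] != 0.
Proof.
move=> nz z21 P1 w w1; apply/negP => /eqP Pw.
rewrite !horner_fiber in P1 Pw.
set k := ((1 - cabs w) / 2) ^+ deg1 p.
have k0 : 0 < k by rewrite exprn_gt0 // divr_gt0 // subr_gt0.
have A0 : 0 < cabs p.[1, z2] by rewrite cabs_gt0.
have e0 : 0 < k * cabs p.[1, z2] / 4 by rewrite divr_gt0 ?mulr_gt0.
have [d1 d10 h1] := poly_continuous p.[w%:P] z2 e0.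
have e1 : 0 < cabs p.[1, z2] / 2 by rewrite divr_gt0.
have [d2 d20 h2] := poly_continuous p.[1%:P] z2 e1.
set t := Num.min (1 / 2) (Num.min d1 d2 / 2).
have t0 : 0 < t.
  by rewrite /t lt_min divr_gt0 //= divr_gt0 // lt_min d10.
have th : t <= 1 / 2 by rewrite /t ge_min lexx.
have td : t < Num.min d1 d2.
  apply: (@le_lt_trans _ _ (Num.min d1 d2 / 2)); first by rewrite /t ge_min lexx orbT.
  have : 0 < Num.min d1 d2 by rewrite lt_min d10.
  lra.
set y := toC (1 - t) * z2.
have y1 : cabs y < 1 by rewrite cabsM z21 mulr1 cabs_toC; lra.
have yz : cabs (z2 - y) = t.
  rewrite /y toCB toC1 mulrBl mul1r opprB addrC subrK cabsM z21 mulr1 cabs_toC //.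
  exact: ltW.
move: td; rewrite lt_min => /andP[td1 td2].
have {}h1 := h1 y; rewrite yz in h1; have {}h1 := h1 td1.
have {}h2 := h2 y; rewrite yz in h2; have {}h2 := h2 td2.
have nzy v : cabs v < 1 -> (fiber p y).[v] != 0.
  move=> v1; rewrite horner_fiber; apply: (nz (v, y)).
  by split; rewrite /= cabsE -toC1 lt_toC.
have := @poly_harnack R (deg1 p) _ w 1 (cabs w) (size_fiber p y) nzy.
rewrite cabs_ge0 w1 lexx cabs1 => /(_ isT isT (lexx _)).
rewrite !horner_fiber -/k.
rewrite Pw sub0r cabsN in h1.
have h3 := cabs_tri p.[1, y] p.[1, z2] 0; rewrite !subr0 in h3.
have h4 : cabs p.[1, z2] / 2 < cabs p.[1, y] by lra.
have : k * (cabs p.[1, z2] / 2) < k * cabs p.[1, y] by rewrite ltr_pM2l.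
lra.
Qed.
End Fiber.

(** * Power series *)

(** The product rule for [x * x ^+ n]. At [n = 0] the truncated exponent [n.-1] is harmless, its
    term being multiplied by zero. *)
Lemma expr_derivS (S : nzRingType) (x : S) n :
  x ^+ n.+1.-1 *+ n.+1 = x ^+ n + x * (x ^+ n.-1 *+ n).
Proof.
rewrite /= mulrS; congr (_ + _).
by case: n => [|n] /=; rewrite ?mulr0n ?mulr0 // mulrnAr exprS.
Qed.

Section PowerSeries.
Variable R : realType.
Local Notation C := (CC R).
Implicit Types (u v a b : nat -> C) (f g : C -> C) (d h e l : C) (x y q r s M : R).

Lemma cvgCP u l : u @ \oo --> l <->
  forall x, 0 < x -> exists N, forall n, (N <= n)%N -> cabs (l - u n) < x.
Proof.
split=> [/cvgrPdist_lt ul x x0|ul].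
  have /ul[N _ hN] : 0 < toC x by rewrite -toC0 lt_toC.
  by exists N => n Nn; have := hN n Nn; rewrite /= cabsE lt_toC.
apply/cvgrPdist_lt => _ /gt0_toC[x x0 ->]; have [N hN] := ul x x0.
by exists N => // n /hN; rewrite /= cabsE lt_toC.
Qed.

Lemma cvgC_sub u v l l' : u @ \oo --> l -> v @ \oo --> l' ->
  (fun n => u n - v n) @ \oo --> l - l'.
Proof.
move=> /cvgCP ul /cvgCP vl; apply/cvgCP => x x0.
have x2 : 0 < x / 2 by rewrite divr_gt0.
have [N1 h1] := ul _ x2; have [N2 h2] := vl _ x2.
exists (maxn N1 N2) => n; rewrite geq_max => /andP[/h1 k1 /h2 k2].
have -> : l - l' - (u n - v n) = (l - u n) - (l' - v n) by ring.
by apply: le_lt_trans (cabsB _ _) _; lra.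
Qed.

Lemma cvgC_scale e u l : u @ \oo --> l -> (fun n => e * u n) @ \oo --> e * l.
Proof.
move=> /cvgCP ul; apply/cvgCP => x x0; have e1 : 0 < cabs e + 1.
  by rewrite ltr_wpDl ?cabs_ge0.
have [|N hN] := ul (x / (cabs e + 1)); first by rewrite divr_gt0.
exists N => n /hN; rewrite ltr_pdivlMr // -mulrBr cabsM => h.
by apply: le_lt_trans h; rewrite mulrC ler_wpM2l ?cabs_ge0 // lerDl.
Qed.

Lemma cvgC_shift u l m : u @ \oo --> l -> (fun n => u (n + m)%N) @ \oo --> l.
Proof.
move=> /cvgCP ul; apply/cvgCP => x /ul[N hN]; exists N => n Nn.
by apply: hN; exact: leq_trans Nn (leq_addr _ _).
Qed.

Lemma cvgC_cst l : (fun=> l) @ \oo --> l.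
Proof. by apply/cvgCP => x x0; exists 0%N => n _; rewrite subrr cabs0. Qed.

Lemma realcvgP (v : nat -> R) x : v @ \oo --> x ->
  forall y, 0 < y -> exists N, forall n, (N <= n)%N -> `|x - v n| < y.
Proof.
by move=> /cvgrPdist_lt h y /h[N _ hN]; exists N => n /hN.
Qed.

Lemma cabs_lim_le u l M : u @ \oo --> l -> (forall n, cabs (u n) <= M) -> cabs l <= M.
Proof.
move=> /cvgCP ul uM; rewrite leNgt; apply/negP => Ml.
have /ul[N hN] : 0 < cabs l - M by rewrite subr_gt0.
have := hN _ (leqnn N); have := uM N; have := cabs_tri (u N) l 0.
rewrite !subr0; lra.
Qed.

Lemma geometric_sum_le q n : 0 <= q < 1 -> \sum_(k < n) q ^+ k <= (1 - q)^-1.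
Proof.
move=> /andP[q0 q1]; have q1' : 0 < 1 - q by rewrite subr_gt0.
rewrite -(ler_pM2l q1') mulfV ?gt_eqF //.
have := subrX1 q n; rewrite -opprB -[q - 1]opprB mulNr => /oppr_inj <-.
by rewrite gerBl exprn_ge0.
Qed.

Lemma sum_geometric_le (v : nat -> R) M q n : 0 <= M -> 0 <= q < 1 ->
  (forall k, v k <= M * q ^+ k) -> \sum_(k < n) v k <= M / (1 - q).
Proof.
move=> M0 q01 vM; apply: (@le_trans _ _ (\sum_(k < n) M * q ^+ k)).
  by apply: ler_sum => k _; exact: vM.
by rewrite -mulr_sumr ler_wpM2l // geometric_sum_le.
Qed.

Lemma real_geometric_cvg (v : nat -> R) M q : 0 <= M -> 0 <= q < 1 ->
  (forall k, `|v k| <= M * q ^+ k) -> cvgn (series v).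
Proof.
move=> M0 /andP[q0 q1] vM; apply: (@normed_cvg _ R^o).
apply: (@series_le_cvg _ _ (geometric M q)) => //.
  by move=> n; exact: normr_ge0.
  by move=> n; rewrite /= mulr_ge0 ?exprn_ge0.
by apply: is_cvg_geometric_series; rewrite ger0_norm.
Qed.

(** Completeness of the reals, applied to the real and imaginary parts, each dominated by the
    geometric series. *)
Lemma complex_geometric_cvg u M q : 0 <= M -> 0 <= q < 1 ->
  (forall k, cabs (u k) <= M * q ^+ k) -> exists l, series u @ \oo --> l.
Proof.
move=> M0 q01 uM.
have /cvg_ex[x /realcvgP hx] : cvgn (series (fun k => complex.Re (u k))).
  by apply: real_geometric_cvg M0 q01 _ => k; exact: le_trans (cabs_Re _) (uM k).
have /cvg_ex[y /realcvgP hy] : cvgn (series (fun k => complex.Im (u k))).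
  by apply: real_geometric_cvg M0 q01 _ => k; exact: le_trans (cabs_Im _) (uM k).
have ReS n : complex.Re (series u n) = series (fun k => complex.Re (u k)) n.
  rewrite !seriesEord /=; elim: n => [|n IH]; first by rewrite !big_ord0.
  by rewrite !big_ord_recr /= -IH; case: (\sum_(i < n) u i) (u n) => ? ? [].
have ImS n : complex.Im (series u n) = series (fun k => complex.Im (u k)) n.
  rewrite !seriesEord /=; elim: n => [|n IH]; first by rewrite !big_ord0.
  by rewrite !big_ord_recr /= -IH; case: (\sum_(i < n) u i) (u n) => ? ? [].
exists (Complex x y : C); apply/cvgCP => z z0.
have z2 : 0 < z / 2 by rewrite divr_gt0.
have [N1 h1] := hx _ z2; have [N2 h2] := hy _ z2.
exists (maxn N1 N2) => n; rewrite geq_max => /andP[/h1 + /h2].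
rewrite -ReS -ImS => k1 k2; apply: le_lt_trans (cabs_ReIm _) _.
by case: (series u n) k1 k2 => p1 p2 /= k1 k2; lra.
Qed.

(** [analytic_at] with its coefficients and a real radius exposed: orders of contact are read off
    the coefficients. *)
Definition expands f d a r : Prop := 0 < r /\
  forall h, cabs h < r -> series (fun k => a k * h ^+ k) @ \oo --> f (d + h).

Lemma analytic_expands f d : analytic_at f d -> exists a r, expands f d a r.
Proof.
move=> [a [_ [/gt0_toC[r r0 ->] fa]]]; exists a, r; split=> // h hr.
by apply: fa; rewrite cabsE lt_toC.
Qed.

Lemma expands_bound f d a r s : expands f d a r -> 0 < s < r ->
  exists2 M, 0 <= M & forall k, cabs (a k) * s ^+ k <= M.
Proof.
move=> [r0 fa] /andP[s0 sr].
have /fa /cvgP /cvg_series_cvg_0 /cvgCP/(_ 1 ltr01)[N hN] : cabs (toC s : C) < r.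
  by rewrite cabs_toC // ltW.
exists (1 + \sum_(k < N) cabs (a k) * s ^+ k) => [|k].
  rewrite addr_ge0 ?sumr_ge0 // => i _.
  by rewrite mulr_ge0 ?cabs_ge0 // exprn_ge0 // ltW.
have pos : 0 <= \sum_(k < N) cabs (a k) * s ^+ k.
  rewrite sumr_ge0 // => i _.
  by rewrite mulr_ge0 ?cabs_ge0 // exprn_ge0 // ltW.
have [/hN|kN] := leqP N k.
  rewrite sub0r cabsN cabsM cabsX cabs_toC ?(ltW s0) // => h.
  by rewrite (le_trans (ltW h)) // lerDl.
rewrite (bigD1 (Ordinal kN)) //= addrCA lerDl addr_ge0 // sumr_ge0 // => i _.
by rewrite mulr_ge0 ?cabs_ge0 // exprn_ge0 // ltW.
Qed.

(** Compare binomial expansions: for [|e| <= x], each term containing [e] is at most [|e| / x] times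
    the corresponding term of [(|h| + x) ^+ n]. No factor [n] appears, so the bound sums against the
    coefficients of a power series. *)
Lemma power_diff1 h e x (n : nat) : 0 < x -> cabs e <= x ->
  x * cabs ((h + e) ^+ n - h ^+ n) <= cabs e * (cabs h + x) ^+ n.
Proof.
move=> x0 ex; elim: n => [|n IH].
  by rewrite !expr0 subrr cabs0 mulr0 mulr1 cabs_ge0.
have -> : (h + e) ^+ n.+1 - h ^+ n.+1 =
    h * ((h + e) ^+ n - h ^+ n) + e * (h + e) ^+ n by rewrite !exprS; ring.
have h1 : cabs ((h + e) ^+ n) <= (cabs h + x) ^+ n.
  rewrite cabsX lerXn2r ?nnegrE ?cabs_ge0 //.
    by rewrite addr_ge0 ?cabs_ge0 // ltW.
  by apply: le_trans (cabsD _ _) _; rewrite lerD2l.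
apply: le_trans (ler_wpM2l (ltW x0) (cabsD _ _)) _; rewrite !cabsM [_ ^+ n.+1]exprS.
have h2 := ler_wpM2l (cabs_ge0 h) IH.
have h3 := ler_wpM2l (mulr_ge0 (ltW x0) (cabs_ge0 e)) h1.
move: h2 h3; move: ((cabs h + x) ^+ n) => T; lra.
Qed.

(** The same comparison for the second-order remainder, whose terms contain [e] at least twice. *)
Lemma power_diff2 h e x (n : nat) : 0 < x -> cabs e <= x ->
  x ^+ 2 * cabs ((h + e) ^+ n - h ^+ n - e * (h ^+ n.-1 *+ n)) <=
    cabs e ^+ 2 * (cabs h + x) ^+ n.
Proof.
move=> x0 ex; elim: n => [|n IH].
  by rewrite !expr0 subrr mulr0n mulr0 subrr cabs0 mulr0 mulr1 exprn_ge0 // cabs_ge0.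
have -> : (h + e) ^+ n.+1 - h ^+ n.+1 - e * (h ^+ n.+1.-1 *+ n.+1) =
    h * ((h + e) ^+ n - h ^+ n - e * (h ^+ n.-1 *+ n)) +
    e * ((h + e) ^+ n - h ^+ n).
  by rewrite expr_derivS !exprS; ring.
have h1 := power_diff1 h n x0 ex.
apply: le_trans (ler_wpM2l (exprn_ge0 2 (ltW x0)) (cabsD _ _)) _.
rewrite !cabsM [_ ^+ n.+1]exprS.
have h2 := ler_wpM2l (cabs_ge0 h) IH.
have h3 := ler_wpM2l (mulr_ge0 (ltW x0) (cabs_ge0 e)) h1.
move: h2 h3; move: ((cabs h + x) ^+ n) => T; lra.
Qed.

Lemma power_deriv_le x y (n : nat) : 0 <= x -> 0 < y ->
  y * (x ^+ n.-1 *+ n) <= (x + y) ^+ n.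
Proof.
move=> x0 y0; elim: n => [|n IH]; first by rewrite mulr0n mulr0.
rewrite expr_derivS.
have h1 : x ^+ n <= (x + y) ^+ n.
  by rewrite lerXn2r ?nnegrE ?addr_ge0 // ?(ltW y0) // lerDl ltW.
rewrite exprS; have h2 := ler_wpM2l x0 IH; have h3 := ler_wpM2l (ltW y0) h1.
move: h2 h3; move: ((x + y) ^+ n) => T; lra.
Qed.

(** Termwise differentiation: summing the second-order remainders gives [|f(d + h + e) - f(d + h) -
    e l| <= B |e|^2], so the difference quotient tends to the sum [l] of the derived series. *)
Lemma expands_derive1 f d a r : expands f d a r ->
  expands (f^`())%classic d (fun k => a k.+1 *+ k.+1) r.
Proof.
move=> /[dup] fa [r0 fl]; split; first exact: r0.
move=> h hr.
(* The choice gives [|h| < |h| + x < s < r], so that the ratio [q] below is less than 1. *)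
set s := (cabs h + r) / 2; set x := (s - cabs h) / 2.
have h0 := cabs_ge0 h.
have s0 : 0 < s < r by rewrite /s; apply/andP; split; lra.
have x0 : 0 < x by rewrite /x /s; lra.
have hxs : cabs h + x < s by rewrite /x /s; lra.
have [M M0 aM] := expands_bound fa s0.
have {s0} /andP[s0 sr] := s0.
set q := (cabs h + x) / s.
have q01 : 0 <= q < 1.
  by rewrite divr_ge0 ?addr_ge0 ?(ltW x0) ?(ltW s0) //= ltr_pdivrMr // mul1r.
have aq k : cabs (a k) * (cabs h + x) ^+ k <= M * q ^+ k.
  rewrite /q exprMn exprVn mulrA ler_pdivlMr ?exprn_gt0 // mulrAC.
  by rewrite ler_wpM2r ?exprn_ge0 // addr_ge0 // ltW.
have [l hl] : exists l, series (fun k => (a k.+1 *+ k.+1) * h ^+ k) @ \oo --> l.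
  apply: (@complex_geometric_cvg _ (M * q / x) q) => // [|k].
    case/andP: q01 => q0 _; apply: divr_ge0; last exact: ltW.
    exact: mulr_ge0.
  rewrite mulrAC ler_pdivlMr // -mulrA -exprS; apply: le_trans (aq _).
  rewrite mulrnAl -mulrnAr cabsM -mulrA ler_wpM2l ?cabs_ge0 //.
  apply: le_trans (power_deriv_le k.+1 h0 x0); rewrite mulrC ler_wpM2l ?(ltW x0) //.
  by rewrite -mulr_natl cabsM cabsX cabs_natr mulr_natl.
set B := M / (1 - q) / x ^+ 2.
have key e : cabs e <= x -> cabs (f (d + (h + e)) - f (d + h) - e * l) <= B * cabs e ^+ 2.
  move=> ex; have her : cabs (h + e) < r.
    by apply: le_lt_trans (cabsD _ _) _; lra.
  have c1 := fl _ her; have c2 := fl _ hr.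
  set S1 := series _ in c1; set S2 := series _ in c2; set T := series _ in hl.
  (* The constant term disappears under differentiation: [n.+1] terms of [f] match [n] terms of the
     derived series, whence the shift by 1. *)
  have c3 := cvgC_sub (cvgC_sub (@cvgC_shift _ _ 1 c1) (@cvgC_shift _ _ 1 c2))
    (@cvgC_scale e _ _ hl).
  apply: (cabs_lim_le c3) => n; rewrite addn1 /S1 /S2 /T !seriesEord /=.
  have -> : \sum_(i < n.+1) a i * (h + e) ^+ i - \sum_(i < n.+1) a i * h ^+ i -
     e * (\sum_(i < n) (a i.+1 *+ i.+1) * h ^+ i) =
     \sum_(i < n.+1) a i * ((h + e) ^+ i - h ^+ i - e * (h ^+ i.-1 *+ i)).
    have -> : e * (\sum_(i < n) (a i.+1 *+ i.+1) * h ^+ i) =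
       \sum_(i < n.+1) a i * (e * (h ^+ i.-1 *+ i)).
      rewrite big_ord_recl mulr0n !mulr0 add0r mulr_sumr; apply: eq_bigr => i _.
      by rewrite /= mulrCA mulrnAl !mulrnAr.
    by rewrite -!sumrB; apply: eq_bigr => i _; ring.
  apply: le_trans (cabs_sum _ _) _.
  rewrite /B mulrAC ler_pdivlMr ?exprn_gt0 // mulr_suml.
  apply: (@le_trans _ _ (\sum_(i < n.+1) cabs e ^+ 2 * (cabs (a i) * (cabs h + x) ^+ i))).
    apply: ler_sum => i _; rewrite cabsM -mulrA [leRHS]mulrCA ler_wpM2l ?cabs_ge0 //.
    by rewrite [leLHS]mulrC power_diff2.
  rewrite -mulr_sumr mulrC ler_wpM2r ?exprn_ge0 ?cabs_ge0 //.
  exact: (sum_geometric_le _ M0 q01 aq).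
suff -> : (f^`())%classic (d + h) = l by [].
have B0 : 0 <= B.
  case/andP: q01 => q0 q1.
  apply: divr_ge0; last by apply: exprn_ge0; exact: ltW.
  by apply: divr_ge0 => //; rewrite subr_ge0; exact: ltW.
apply: cvg_lim; first exact: norm_hausdorff.
apply/cvgrPdist_lt => _ /gt0_toC[y y0 ->].
apply: (@cabs_near _ 0 _ (Num.min x (y / (B + 1)))) => [|e].
  by rewrite lt_min x0 divr_gt0 // ltr_wpDl.
rewrite sub0r cabsN lt_min => /andP[ex ey] e0.
have ce0 : 0 < cabs e by rewrite cabs_gt0.
rewrite cabsE lt_toC /= -(ltr_pM2l ce0) -cabsM mulrBr.
have -> : e * (e^-1 *: (f (e + (d + h)) - f (d + h))) = f (d + (h + e)) - f (d + h).
  by rewrite /GRing.scale /= mulVKf //; congr (f _ - _); ring.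
rewrite cabsBC; apply: le_lt_trans (key _ (ltW ex)) _.
move: ey; rewrite ltr_pdivlMr ?ltr_wpDl // => ey.
rewrite expr2 mulrCA ltr_pM2l // mulrC; apply: le_lt_trans ey.
by rewrite mulrDr mulr1 lerDl ltW.
Qed.

Lemma expands_derive1n f d a r n : expands f d a r ->
  (f^`(n))%classic d = a n *+ n`!.
Proof.
elim: n f a => [|n IH] f a fa.
  rewrite derive1n0 fact0 mulr1n; case: fa => r0 /(_ 0).
  rewrite cabs0 addr0 => /(_ r0) h; apply/esym.
  apply: (@cvg_unique _ (@norm_hausdorff _ C) _ _ _ _ _ h).
  apply/cvgCP => x x0; exists 1%N => -[//|m] _.
  rewrite seriesEord /= big_ord_recl expr0 mulr1 big1 ?addr0 ?subrr ?cabs0 //.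
  by move=> i _; rewrite /bump exprS mul0r mulr0.
by rewrite derive1Sn (IH _ _ (expands_derive1 fa)) factS -mulrnA.
Qed.

Lemma expands_taylor f d a r n : expands f d a r -> exists (B e : R), [/\ 0 <= B, 0 < e &
  forall h, cabs h <= e ->
    cabs (f (d + h) - \sum_(k < n) a k * h ^+ k) <= B * cabs h ^+ n].
Proof.
move=> /[dup] fa [r0 fl]; have s0 : 0 < r / 2 < r by apply/andP; split; lra.
have [M M0 aM] := expands_bound fa s0.
set s := r / 2 in s0 aM; clearbody s; have {s0} /andP[s0 sr] := s0.
(* On [|h| <= s / 2] the tail is dominated by a geometric series of ratio [1 / 2] starting at
   [M * (|h| / s) ^+ n]; its sum brings the factor 2. *)
exists (M * 2 / s ^+ n), (s / 2); split => [||h hs].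
- by rewrite divr_ge0 ?mulr_ge0 // exprn_ge0 // ltW.
- by rewrite divr_gt0.
have hr : cabs h < r by lra.
have c := fl _ hr; set S := series _ in c.
have c' := cvgC_sub (@cvgC_shift _ _ n c) (cvgC_cst (l := \sum_(k < n) a k * h ^+ k)).
apply: (cabs_lim_le c') => m.
rewrite /S seriesEord /= addnC big_split_ord /= addrAC subrr add0r.
apply: le_trans (cabs_sum _ _) _.
have -> : M * 2 / s ^+ n * cabs h ^+ n = M * (cabs h / s) ^+ n / (1 - 1 / 2).
  have -> : (1 - 1 / 2)^-1 = 2 :> R.
    by apply: (mulIf (x := 1 - 1 / 2)); [lra|rewrite mulVf; lra].
  by rewrite exprMn exprVn; ring.
apply: (@sum_geometric_le (fun i => cabs (a (n + i)%N * h ^+ (n + i)))).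
- by rewrite mulr_ge0 ?exprn_ge0 // divr_ge0 ?cabs_ge0 // ltW.
- by apply/andP; split; lra.
move=> k; rewrite -mulrA cabsM cabsX.
apply: (@le_trans _ _ (M * (cabs h / s) ^+ (n + k))).
  rewrite exprMn exprVn mulrA ler_pdivlMr ?exprn_gt0 // mulrAC.
  by rewrite ler_wpM2r ?exprn_ge0 // cabs_ge0.
rewrite ler_wpM2l // exprD ler_wpM2l ?exprn_ge0 ?divr_ge0 ?cabs_ge0 ?(ltW s0) //.
rewrite lerXn2r ?nnegrE ?divr_ge0 ?cabs_ge0 ?(ltW s0) // ler_pdivrMr //; lra.
Qed.

End PowerSeries.

(** * Order of contact *)

Section Contact.
Variable R : realType.
Local Notation C := (CC R).
Implicit Types (f g : C -> C) (a b : nat -> C) (d h z zeta : C) (e M : R).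

Lemma circle_point_near1 e : 0 < e ->
  exists zeta : C, [/\ cabs zeta = 1, zeta != 1 & cabs (1 - zeta) < e].
Proof.
move=> e0; set s := e / 4; have s0 : 0 < s by rewrite divr_gt0.
(* With [w = 1 - i s] the quotient is unimodular, and [1 - conj(w) / w = - 2 i s / w] is nonzero of
   modulus at most [2 s]. *)
pose w : C := Complex 1 (- s); exists (w^* / w).
have w1 : 1 <= cabs w by have := cabs_Re w; rewrite /= normr1.
have w0 : w != 0 by rewrite -cabs_gt0; exact: lt_le_trans w1.
have wE : w - w^* = Complex 0 (- (2 * s)).
  by apply/eqP; rewrite eq_complex /=; apply/andP; split; apply/eqP; ring.
have E : 1 - w^* / w = Complex 0 (- (2 * s)) / w by rewrite -wE mulrBl mulfV.
split.
- by rewrite cabsM cabsV cabs_conj mulfV // cabs_eq0.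
- rewrite eq_sym -subr_eq0 E mulf_eq0 invr_eq0 (negPf w0) orbF eq_complex /= eqxx /=.
  by rewrite oppr_eq0 mulf_eq0 gt_eqF // gt_eqF.
rewrite E cabsM cabsV ltr_pdivrMr ?(lt_le_trans _ w1) //.
apply: (@lt_le_trans _ _ (e * 1)); last by rewrite ler_wpM2l // ltW.
apply: le_lt_trans (cabs_ReIm _) _; rewrite /= normr0 add0r normrN ger0_norm.
  by rewrite /s; lra.
by rewrite mulr_ge0 // ltW.
Qed.

Lemma expands0 f d a r : expands f d a r -> f d = a 0%N.
Proof. by move=> /(expands_derive1n 0); rewrite fact0 mulr1n. Qed.

Lemma expands_sub_taylor f g d a b r r' n : expands f d a r -> expands g d b r' ->
  exists (B e : R), [/\ 0 <= B, 0 < e & forall h, cabs h <= e ->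
    cabs (f (d + h) - g (d + h) - \sum_(k < n) (a k - b k) * h ^+ k) <=
      B * cabs h ^+ n].
Proof.
move=> /(expands_taylor n)[B1 [e1 [B10 e10 h1]]].
move=> /(expands_taylor n)[B2 [e2 [B20 e20 h2]]].
exists (B1 + B2), (Num.min e1 e2); split; [exact: addr_ge0|by rewrite lt_min e10|].
move=> h; rewrite le_min => /andP[/h1 k1 /h2 k2].
have -> : \sum_(k < n) (a k - b k) * h ^+ k =
   \sum_(k < n) a k * h ^+ k - \sum_(k < n) b k * h ^+ k.
  by rewrite -sumrB; apply: eq_bigr => k _; rewrite mulrBl.
move: (\sum_(k < n) a k * _) (\sum_(k < n) b k * _) k1 k2 => u v k1 k2.
have -> : f (d + h) - g (d + h) - (u - v) = (f (d + h) - u) - (g (d + h) - v) by ring.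
by apply: le_trans (cabsB _ _) _; rewrite mulrDl lerD.
Qed.

(** Were all coefficients up to [K] equal, Taylor expansion would bound [f - g] by a multiple of
    [|1 - zeta| ^+ K.+1], too small for the lower bound on the circle. *)
Lemma contact_le f g a b r r' (K : nat) (c e : R) :
  expands f 1 a r -> expands g 1 b r' -> 0 < c -> 0 < e ->
  (forall zeta, cabs zeta = 1 -> zeta != 1 -> cabs (1 - zeta) < e ->
    c * cabs (1 - zeta) ^+ K <= cabs (f zeta - g zeta)) ->
  exists2 k, (k <= K)%N & a k != b k.
Proof.
move=> fa gb c0 e0 lb; apply: contrapT => no.
have ab k : (k <= K)%N -> a k = b k.
  by move=> kK; apply/eqP; apply: contra_notT no => abk; exists k.
have [B [e1 [B0 e10 hB]]] := expands_sub_taylor K.+1 fa gb.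
have B1 : 0 < B + 1 by rewrite ltr_wpDl.
have : 0 < Num.min (Num.min e e1) (c / (B + 1)) by rewrite !lt_min e0 e10 divr_gt0.
move=> /circle_point_near1[z [z1 zn1]]; rewrite !lt_min => /andP[/andP[ze ze1]].
rewrite ltr_pdivlMr // => zB.
have h0 : 0 < cabs (1 - z) by rewrite cabs_gt0 subr_eq0 eq_sym.
have := lb z z1 zn1 ze; have := hB (z - 1); rewrite (cabsBC z 1) => /(_ (ltW ze1)).
rewrite big1 ?subr0; last by move=> k _; rewrite ab ?subrr ?mul0r // -ltnS.
rewrite (addrC 1) subrK => k1 k2; have := le_trans k2 k1.
rewrite exprSr mulrA -mulrA [_ ^+ K * _]mulrC mulrA ler_pM2r ?exprn_gt0 //.
by rewrite mulrC; lra.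
Qed.

(** At the first differing index [n], [|f - g|] is comparable to [|1 - zeta| ^+ n]. An upper bound
    of order [K] at points arbitrarily close to 1 then forbids [n < K]. *)
Lemma contact_ge f g a b r r' (K n : nat) M :
  expands f 1 a r -> expands g 1 b r' -> 0 <= M ->
  (forall e, 0 < e -> exists zeta, [/\ zeta != 1, cabs (1 - zeta) < e &
     cabs (f zeta - g zeta) <= M * cabs (1 - zeta) ^+ K]) ->
  (forall k, (k < n)%N -> a k = b k) -> a n != b n -> (K <= n)%N.
Proof.
move=> fa gb M0 ub ab abn; rewrite leqNgt; apply/negP => nK.
have [B [e1 [B0 e10 hB]]] := expands_sub_taylor n.+1 fa gb.
have MB1 : 0 < M + B + 1 by rewrite ltr_wpDl // addr_ge0.
have d0 : 0 < cabs (a n - b n) by rewrite cabs_gt0 subr_eq0.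
(* The threshold forces [(M + B) * |1 - zeta| < |a n - b n|]; the bound 1 allows replacing the
   exponent [K] by [n.+1]. *)
have : 0 < Num.min (Num.min 1 e1) (cabs (a n - b n) / (M + B + 1)).
  by rewrite !lt_min ltr01 e10 divr_gt0.
move=> /ub[z [zn1]]; rewrite !lt_min => /andP[/andP[z1 ze1]].
rewrite ltr_pdivlMr // => zB k1.
have h0 : 0 < cabs (1 - z) by rewrite cabs_gt0 subr_eq0 eq_sym.
have := hB (z - 1); rewrite (cabsBC z 1) => /(_ (ltW ze1)).
rewrite big_ord_recr /= big1 ?add0r; last first.
  by move=> k _; rewrite ab ?subrr ?mul0r.
rewrite (addrC 1) subrK => k2.
have k3 : cabs (a n - b n) * cabs (1 - z) ^+ n <=
    cabs (f z - g z) + B * cabs (1 - z) ^+ n.+1.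
  rewrite -lerBlDl; apply: le_trans k2; rewrite (cabsBC (f z - g z)).
  have := cabsD_ge ((a n - b n) * (z - 1) ^+ n) (- (f z - g z)).
  by rewrite cabsN cabsM cabsX (cabsBC z 1).
have k4 : M * cabs (1 - z) ^+ K <= M * cabs (1 - z) ^+ n.+1.
  by rewrite ler_wpM2l // ler_wiXn2l // ltW.
have : cabs (a n - b n) * cabs (1 - z) ^+ n <=
    (M + B) * cabs (1 - z) * cabs (1 - z) ^+ n.
  by rewrite -mulrA -exprS; lra.
rewrite ler_pM2r ?exprn_gt0 //; lra.
Qed.

(** Derivatives at [d] are factorials times coefficients, so the order of contact is the least index
    where the coefficients differ. It is positive because [f d = g d]. *)
Lemma expands_order_of_contact f g d a b r r' (K : nat) :
  expands f d a r -> expands g d b r' -> f d = g d ->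
  (exists2 k, (k <= K)%N & a k != b k) ->
  exists n, [/\ (n <= K)%N, order_of_contact f g d n,
                forall k, (k < n)%N -> a k = b k & a n != b n].
Proof.
move=> fa gb fg [k0 k0K abk0]; have ex : exists k, a k != b k by exists k0.
case: (ex_minnP ex) => n abn min; exists n.
have lt k : (k < n)%N -> a k = b k.
  by move=> kn; apply/eqP; apply: contraLR kn => /min; rewrite -leqNgt.
split=> //; first exact: leq_trans (min _ abk0) _.
split.
- rewrite lt0n; apply: contra_neq abn => ->.
  by rewrite -(expands0 fa) -(expands0 gb).
- rewrite (expands_derive1n n fa) (expands_derive1n n gb) => /eqP.
  by rewrite eqr_pMn2r ?fact_gt0 // (negPf abn).
- by move=> k /andP[_ /lt kn]; rewrite (expands_derive1n k fa) (expands_derive1n k gb) kn.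
Qed.

Lemma expands_continuous f d a r : expands f d a r ->
  forall e, 0 < e -> exists2 e', 0 < e' &
    forall z, cabs (d - z) < e' -> cabs (f d - f z) < e.
Proof.
move=> fa e e0; have [B [e1 [B0 e10 hB]]] := expands_taylor 1 fa.
have B1 : 0 < B + 1 by rewrite ltr_wpDl.
exists (Num.min e1 (e / (B + 1))); first by rewrite lt_min e10 divr_gt0.
move=> z; rewrite lt_min => /andP[z1]; rewrite ltr_pdivlMr // => z2.
have := hB (z - d); rewrite (cabsBC z d) => /(_ (ltW z1)).
rewrite big_ord1 expr0 mulr1 expr1 (addrC d) subrK -(expands0 fa) (cabsBC (f z)) => h.
by apply: le_lt_trans h _; have := cabs_ge0 (d - z); lra.
Qed.
End Contact.

(** * Zero branches *)

Section Cayley.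
Variable R : realType.
Local Notation C := (CC R).
Implicit Types (z w : C).

Lemma beta0 : beta (0 : C) = 1.
Proof. by rewrite /beta mulr0 addr0 subr0 divr1. Qed.

Lemma cabs_1D z : cabs (1 - z) < 1 -> 1 < cabs (1 + z).
Proof.
move=> h; have := cabsD_ge 2 (- (1 - z)); rewrite cabsN.
have -> : 2 + - (1 - z) = 1 + z by ring.
by rewrite cabs_natr; lra.
Qed.

Lemma cabs_beta_inv z : cabs (1 - z) < 1 -> cabs (beta_inv z) <= cabs (1 - z).
Proof.
move=> /cabs_1D h; rewrite /beta_inv !cabsM cabs_i mul1r cabsV ler_pdivrMr; last by lra.
by rewrite ler_peMr ?cabs_ge0 // ltW.
Qed.

Lemma beta_invK z : cabs (1 - z) < 1 -> beta (beta_inv z) = z.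
Proof.
move=> /cabs_1D h; have z1 : 1 + z != 0 by rewrite -cabs_gt0; lra.
rewrite /beta /beta_inv.
have -> : 'i * ('i * ((1 - z) / (1 + z))) = - ((1 - z) / (1 + z)) :> C.
  by rewrite mulrA -expr2 sqrCi mulN1r.
have -> : 1 - - ((1 - z) / (1 + z)) = 2 / (1 + z) by field.
have -> : 1 + - ((1 - z) / (1 + z)) = 2 * z / (1 + z) by field.
field.
exact: z1.
Qed.

Lemma beta_inv_neq0 z : cabs (1 - z) < 1 -> z != 1 -> beta_inv z != 0.
Proof.
move=> /beta_invK zE; apply: contra_neq => z0.
by rewrite -zE z0 beta0.
Qed.

Lemma beta_inv1 : beta_inv (1 : C) = 0.
Proof. by rewrite /beta_inv subrr mul0r mulr0. Qed.

Lemma cabs_1_sub_iM w : cabs w <= 1 / 2 -> 1 / 2 <= cabs (1 - 'i * w).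
Proof.
move=> h; have := cabsD_ge 1 (- ('i * w)); rewrite cabs1 cabsN cabsM cabs_i; lra.
Qed.

Lemma cabs_beta w : cabs w <= 1 / 2 -> cabs (1 - beta w) <= 4 * cabs w.
Proof.
move=> /[dup] /cabs_1_sub_iM h wh.
have n0 : 1 - 'i * w != 0 by rewrite -cabs_gt0; lra.
have -> : 1 - beta w = - 2 * 'i * w / (1 - 'i * w) by rewrite /beta; field.
rewrite !cabsM cabsV cabs_i cabsN cabs_natr ler_pdivrMr; last by lra.
have := cabs_ge0 w => w0; rewrite mulr1.
have := ler_wpM2l w0 h; lra.
Qed.

(** The [N] distinct values [rho j w] are already roots of [X^N - w]; one more root would exceed the
    degree. *)
Lemma root_branch_surj N (rho : 'I_N -> C -> C) (w t : C) : (0 < N)%N ->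
  root_branches rho -> w != 0 -> t ^+ N = w -> exists j, t = rho j w.
Proof.
move=> N0 [rhoN inj _] w0 tw.
pose s := [seq rho j w | j <- enum 'I_N].
have us : uniq s by rewrite map_inj_uniq ?enum_uniq //; exact: inj.
have [/mapP[j _ ->]|ts] := boolP (t \in s); first by exists j.
have := @max_poly_roots _ ('X^N - w%:P) (t :: s).
rewrite /= ts us size_XnsubC // size_map size_enum_ord ltnn.
rewrite -size_poly_gt0 size_XnsubC // => /(_ isT) h; suff : false by [].
apply: h => //; rewrite /root !hornerE tw subrr eqxx /=.
by apply/allP => _ /mapP[j _ ->]; rewrite /= !hornerE rhoN subrr.
Qed.

Lemma weierstrass_degree_gt0 N (f : C * C -> C) :
  weierstrass_polynomial N f -> irreducible_germ f -> (0 < N)%N.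
Proof.
case: N => // -[a [_ fE]] [_ f0 _]; move: f0; rewrite fE big_ord0 addr0 expr0.
by move/eqP; rewrite oner_eq0.
Qed.

Lemma branch_contactP (psi : C -> C) K : branch_contact_order psi K ->
  exists (c1 c2 e : R), [/\ 0 < c1, 0 < c2, 0 < e & forall zeta,
    cabs zeta = 1 -> cabs (1 - zeta) < e ->
    c1 * cabs (1 - zeta) ^+ K <= 1 - cabs (psi zeta) <= c2 * cabs (1 - zeta) ^+ K].
Proof.
move=> [_ [_ [_ [/gt0_toC[c1 c10 ->] /gt0_toC[c2 c20 ->] /near1P[e e0 h]]]]].
exists c1, c2, e; split=> // z /normE1 z1 ze; have := h z ze z1.
by rewrite !cabsE -!toCX -!toCM -toC1 -toCB !le_toC.
Qed.

Lemma holomorphic2_neq0 (f : C * C -> C) : holomorphic2_at f (0, 0) ->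
  f (0, 0) <> 0 -> exists2 e : R, 0 < e &
    forall w1 w2, cabs w1 < e -> cabs w2 < e -> f (w1, w2) != 0.
Proof.
move=> /nbhs_singleton /differentiable_continuous fc /eqP f0.
have /cvgrPdist_lt/(_ (toC (cabs (f (0, 0))))) := fc.
rewrite -toC0 lt_toC cabs_gt0 => /(_ f0)/near2P[e e0 h]; exists e => // w1 w2 h1 h2.
have := h w1 w2; rewrite !sub0r !cabsN => /(_ h1 h2).
rewrite cabsE lt_toC; apply: contraTneq => ->.
by rewrite subr0 ltxx.
Qed.
End Cayley.

(** * Depth of the zeros of the reflection inside the disk *)

Section ContactOrder.
Variable R : realType.
Local Notation C := (CC R).
Implicit Types (p : {poly {poly C}}) (z w zeta : C) (K : nat).

Lemma pullback_eq0 p w1 w2 : cabs w1 <= 1 / 2 -> cabs w2 <= 1 / 2 ->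
  (pullback p (w1, w2) == 0) = ((reflection p).[beta w1, beta w2] == 0).
Proof.
move=> h1 h2; rewrite /pullback /= !mulf_eq0 !expf_eq0.
have n w : cabs w <= 1 / 2 -> (1 - 'i * w == 0) = false.
  by move=> /cabs_1_sub_iM h; apply/negbTE; rewrite -cabs_gt0; lra.
by rewrite !n // !andbF.
Qed.

(** By the factorization and the Puiseux parametrizations, every zero near [(1, 1)] with [zeta <> 1]
    lies on one of finitely many branches, of contact order at most [K]; since [|1 - zeta| < 1], the
    exponent may be raised to [K]. *)
Lemma z1_contact_order_lower p K : z1_contact_order p K ->
  exists2 c : R, 0 < c <= 1 / 2 & forall z zeta, cabs zeta = 1 -> zeta != 1 ->
    cabs (1 - zeta) < c -> cabs (1 - z) < c -> (reflection p).[z, zeta] = 0 ->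
    c * cabs (1 - zeta) ^+ K <= 1 - cabs z.
Proof.
move=> [L [N [psi [kappa [[alpha [q [Psi [rho [[ah a0] fac qs ps psiE]]]]] bc KE]]]]].
have [e1 e10 facP] := near2P fac.
have [e2 e20 alphaP] := holomorphic2_neq0 ah a0.
have [e3 e30 psP] : exists2 e, 0 < e & forall k w1 w2, cabs w1 < e -> cabs w2 < e ->
    q k (w1, w2) = 0 -> exists t, t ^+ N k = w2 /\ w1 = Psi k t.
  apply: uniform_threshold => [k x y /andP[x0 xy] h w1 w2 h1 h2|k].
    by apply: h; [exact: lt_le_trans h1 _|exact: lt_le_trans h2 _].
  have [[_ _ /near2P[e e0 h]] _] := ps k; exists e => // w1 w2 h1 h2.
  by have := h w1 w2; rewrite !sub0r !cabsN => /(_ h1 h2) [].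
(* One [e] serves as radius and as lower constant: decreasing it weakens the claim in both roles. *)
have [e4 e40 bcP] : exists2 e, 0 < e & forall k j zeta, cabs zeta = 1 ->
    cabs (1 - zeta) < e ->
    e * cabs (1 - zeta) ^+ kappa k j <= 1 - cabs (psi k j zeta).
  apply: uniform_threshold => [k x y /andP[x0 xy] h j z z1 zx|k].
    apply: le_trans (h j z z1 (lt_le_trans zx xy)).
    by rewrite ler_wpM2r // exprn_ge0 // cabs_ge0.
  apply: uniform_threshold => [j x y /andP[x0 xy] h z z1 zx|j].
    apply: le_trans (h z z1 (lt_le_trans zx xy)).
    by rewrite ler_wpM2r // exprn_ge0 // cabs_ge0.
  have [c1 [c2 [e [c10 _ e0 h]]]] := branch_contactP (bc k j).
  exists (Num.min c1 e); first by rewrite lt_min c10.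
  move=> z z1; rewrite lt_min => /andP[_ ze]; have /andP[h1 _] := h z z1 ze.
  apply: le_trans h1; rewrite ler_wpM2r ?exprn_ge0 ?cabs_ge0 //.
  by rewrite ge_min lexx.
(* The bound [1 / 2] keeps both points where [beta (beta_inv z) = z] and where the prefactors of
   [pullback] do not vanish. *)
pose c := Num.min (1 / 2) (Num.min (Num.min e1 e2) (Num.min e3 e4)).
exists c; first by rewrite /c !lt_min e10 e20 e30 e40 divr_gt0 // ge_min lexx.
move=> z zeta zeta1 zetan1 zetac zc Qz.
move: zetac zc; rewrite {1 2}/c !lt_min.
move=> /and3P[t0 /andP[t1 t2] /andP[t3 t4]] /and3P[s0 /andP[s1 s2] /andP[s3 s4]].
have t5 : cabs (1 - zeta) < 1 by lra.
have s5 : cabs (1 - z) < 1 by lra.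
have tb := cabs_beta_inv t5; have sb := cabs_beta_inv s5.
set w1 := beta_inv z in sb; set w2 := beta_inv zeta in tb.
have : pullback p (w1, w2) == 0.
  by rewrite pullback_eq0 ?beta_invK ?Qz //;
    [exact: ltW (le_lt_trans sb s0)|exact: ltW (le_lt_trans tb t0)].
rewrite (facP w1 w2) ?sub0r ?cabsN ?(le_lt_trans sb) ?(le_lt_trans tb) //.
rewrite mulf_eq0 (negPf (alphaP _ _ _ _)) ?(le_lt_trans sb) ?(le_lt_trans tb) //=.
rewrite prodf_seq_eq0 => /hasP[k _ /= /eqP qk].
have [t [tN w1E]] := psP k w1 w2 (le_lt_trans sb s3) (le_lt_trans tb t3) qk.
have [qw qi] := qs k; have N0 := weierstrass_degree_gt0 qw qi.
have w20 : w2 != 0 by exact: beta_inv_neq0.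
(* The Puiseux parameter [t] is some root of [w2 <> 0], hence a value of one of the chosen root
   branches. *)
have [j tE] := root_branch_surj N0 (ps k).2 w20 tN.
have zE : z = psi k j zeta by rewrite psiE -/w2 -tE -w1E beta_invK.
rewrite [z in leRHS]zE; apply: le_trans (bcP k j zeta zeta1 t4).
have kK : (kappa k j <= K)%N.
  rewrite KE; apply: leq_trans (leq_bigmax k).
  exact: (leq_bigmax (F := fun j => kappa k j)).
apply: ler_pM; rewrite ?exprn_ge0 ?cabs_ge0 //.
- by rewrite /c !le_min !(ltW e10, ltW e20, ltW e30, ltW e40) divr_ge0.
- by rewrite /c !ge_min lexx !orbT.
- by rewrite ler_wiXn2l ?cabs_ge0 // ltW.
Qed.

(** A branch of maximal contact order has the required depth. It passes through [(1, 1)], so contact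
    order 0 would give [c1 <= 0] at [zeta = 1]; hence [K > 0]. *)
Lemma z1_contact_order_branch p K : p != 0 -> p.[1, 1] = 0 -> z1_contact_order p K ->
  (0 < K)%N /\ exists (psi : C -> C) (c : R), 0 < c /\
    forall d : R, 0 < d -> exists2 e : R, 0 < e & forall zeta, cabs zeta = 1 ->
      cabs (1 - zeta) < e -> [/\ (reflection p).[psi zeta, zeta] = 0,
        cabs (1 - psi zeta) < d & 1 - cabs (psi zeta) <= c * cabs (1 - zeta) ^+ K].
Proof.
move=> p0 p11.
move=> [L [N [psi [kappa [[alpha [q [Psi [rho [[ah a0] fac qs ps psiE]]]]] bc KE]]]]].
have Q11 : (reflection p).[1, 1] = 0.
  by rewrite horner2_reflection ?oner_neq0 // rmorph1 divr1 p11 rmorph0 mulr0.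
(* The pullback vanishes at the origin, so there is at least one factor and the maximum is
   attained. *)
have [k0 _] : exists2 k : 'I_L, k \in index_enum 'I_L & q k (0, 0) == 0.
  have := nbhs_singleton fac; have : pullback p (0, 0) == 0.
    by rewrite pullback_eq0 ?cabs0 ?divr_ge0 // !beta0 Q11.
  move=> /eqP -> /esym/eqP; rewrite mulf_eq0 => /orP[/eqP //|].
  by rewrite prodf_seq_eq0 => /hasP[k kL qk]; exists k.
move=> _.
have NG k : (0 < N k)%N by have [qw qi] := qs k; exact: weierstrass_degree_gt0 qw qi.
have L0 : (0 < #|'I_L|)%N by rewrite card_ord (leq_ltn_trans _ (ltn_ord k0)).
have [k kE] := bigop.eq_bigmax (fun k => \max_(j < N k) kappa k j)%N L0.
have N0 : (0 < #|'I_(N k)|)%N by rewrite card_ord.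
have [j jE] := bigop.eq_bigmax (fun j => kappa k j) N0.
have {}KE : K = kappa k j.
  by rewrite KE; transitivity (\max_(j < N k) kappa k j)%N; [exact: kE|exact: jE].
have [c1 [c2 [e1 [c10 c20 e10 bcP]]]] := branch_contactP (bc k j).
have [[/analytic_expands[a [r Pa]] P0 /near2P[e2 e20 psP]] [rhoN _ _]] := ps k.
have [e3 e30 facP] := near2P fac.
split.
  rewrite lt0n; apply/eqP => K0; have := bcP 1.
  rewrite cabs1 subrr cabs0 -KE K0 expr0 mulr1 => /(_ erefl e10) /andP[+ _].
  have := rhoN j 0 => /eqP; rewrite expf_eq0 => /andP[_ /eqP r0].
  by rewrite psiE beta_inv1 r0 P0 beta0 cabs1 subrr leNgt c10.
exists (psi k j), c2; split=> // d d0.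
set y := Num.min (1 / 2) (Num.min (Num.min e2 e3) (d / 4)).
have y0 : 0 < y by rewrite /y !lt_min e20 e30 !divr_gt0.
have [x x0 Pc] := expands_continuous Pa y0.
(* The radius [x ^+ N k] for [w2] makes its root [t] smaller than [x]. *)
exists (Num.min (Num.min e1 (1 / 2)) (Num.min (Num.min e2 e3) (x ^+ N k))).
  by rewrite !lt_min e10 e20 e30 exprn_gt0 // divr_gt0.
move=> z z1; rewrite !lt_min => /andP[/andP[ze1 zh] /andP[/andP[ze2 ze3] zx]].
have zl1 : cabs (1 - z) < 1 by lra.
have w2b := cabs_beta_inv zl1; set w2 := beta_inv z in w2b.
set t := rho k j w2; set w1 := Psi k t.
have tx : cabs (0 - t) < x.
  rewrite sub0r cabsN -(ltr_pXn2r (NG k)) ?nnegrE ?cabs_ge0 ?(ltW x0) //.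
  by rewrite -cabsX rhoN; exact: le_lt_trans zx.
have := Pc t tx; rewrite P0 sub0r cabsN -/w1 /y !lt_min.
move=> /andP[w1h /andP[/andP[w1e2 w1e3] w1d]].
have psiz : psi k j z = beta w1 by rewrite psiE.
have w1h' := ltW w1h.
split.
- rewrite psiz -[z in LHS](beta_invK zl1) -/w2; apply/eqP.
  rewrite -pullback_eq0 //; last by apply: ltW; exact: le_lt_trans w2b zh.
  rewrite (facP w1 w2) ?sub0r ?cabsN ?(le_lt_trans w2b) //.
  rewrite mulf_eq0; apply/orP; right; rewrite prodf_seq_eq0; apply/hasP.
  exists k; rewrite ?mem_index_enum //=; apply/eqP.
  have := psP w1 w2; rewrite !sub0r !cabsN => /(_ w1e2 (le_lt_trans w2b ze2))[_].
  by apply; exists t; rewrite rhoN.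
- by rewrite psiz; apply: le_lt_trans (cabs_beta w1h') _; lra.
- by have := bcP z z1 ze1; rewrite -KE => /andP[].
Qed.
End ContactOrder.

(** * Level curves *)

Section OneFiber.
Variable R : realType.
Local Notation C := (CC R).
Implicit Types (P Q : {poly C}) (a z w lam mu : C).

Lemma unimodular_dist lam mu : cabs lam = 1 -> cabs mu = 1 -> cabs (lam - mu) <= 2.
Proof. by move=> h1 h2; have := cabsB lam mu; rewrite h1 h2; lra. Qed.

(** Otherwise [Q - lam P] and [Q - mu P], hence [P] and [Q], are almost constant near [a], up to the
    point [a / |a|] included. There [|Q| = |P|], while [Q(a) = 0] keeps [Q] small. *)
Lemma level_hit m P Q a lam mu : (size P <= m.+1)%N -> (size Q <= m.+1)%N ->
  (forall w, cabs w = 1 -> cabs Q.[w] = cabs P.[w]) ->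
  Q.[a] = 0 -> 0 < cabs a < 1 -> cabs lam = 1 -> cabs mu = 1 -> lam != mu ->
  exists2 z, cabs (z - a) <= 2 ^+ m * 8 / cabs (lam - mu) * (1 - cabs a) &
    Q.[z] = lam * P.[z] \/ Q.[z] = mu * P.[z].
Proof.
move=> sP sQ PQ Qa /andP[a0 a1] l1 m1 lm.
set D := cabs (lam - mu); have D0 : 0 < D by rewrite cabs_gt0 subr_eq0.
have D2 : D <= 2 := unimodular_dist l1 m1.
have T1 : 1 <= 2 ^+ m :> R by rewrite exprn_ege1 // ler1n.
set T : R := 2 ^+ m in T1 *; have T0 : 0 < T by lra.
set rho := T * 8 / D * (1 - cabs a).
have rho0 : 0 < rho by rewrite /rho !mulr_gt0 ?invr_gt0 // subr_gt0.
apply: contrapT => no.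
have nz nu w : (nu = lam \/ nu = mu) -> cabs (w - a) < rho -> (Q - nu *: P).[w] != 0.
  move=> nuE wa; rewrite !hornerE subr_eq0; apply: contra_notN no => /eqP Qw.
  by exists w; [exact: ltW|case: nuE => <-; [left|right]].
(* [d * rho = 1 - |a|] is the distance from [a] to [a / |a|], and the variation constant
   [d * 2 ^+ m] of [near_const] becomes [D / 8]. *)
pose d := D / (T * 8).
have d0 : 0 < d by rewrite /d divr_gt0 // mulr_gt0.
have dT : d * T = D / 8 by rewrite /d; field; exact: lt0r_neq0.
have d1 : d <= 1.
  have : d * 1 <= d * T by rewrite ler_wpM2l // ltW.
  lra.
pose z := a / toC (cabs a).
have ca : toC (cabs a) != 0 :> C by rewrite -toC0 (inj_eq (@toC_inj R)) gt_eqF.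
have z1 : cabs z = 1.
  by rewrite cabsM cabsV cabs_toC ?cabs_ge0 // mulfV // gt_eqF.
have za : cabs (z - a) = d * rho.
  have -> : z - a = z * toC (1 - cabs a).
    by rewrite toCB toC1 mulrBr mulr1 divfK.
  rewrite cabsM z1 mul1r cabs_toC ?subr_ge0 1?ltW //.
  rewrite /rho /d; field; rewrite !gt_eqF //.
have nc nu : (nu = lam \/ nu = mu) -> cabs nu = 1 ->
    cabs (Q.[z] - nu * P.[z] + nu * P.[a]) <= D / 8 * cabs P.[a].
  move=> nuE nu1; have sz : (size (Q - nu *: P)%R <= m.+1)%N.
    apply: leq_trans (size_polyD _ _) _; rewrite size_polyN geq_max sQ.
    exact: leq_trans (size_scale_leq _ _) sP.
  have d01 : 0 <= d <= 1 by rewrite (ltW d0).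
  have zad : cabs (z - a) <= d * rho by rewrite za.
  have := near_const sz d01 (fun w => nz nu w nuE) zad rho0.
  by rewrite !hornerE Qa sub0r cabsN opprK cabsM nu1 mul1r -/T dT.
have h1 := nc lam (or_introl erefl) l1; have h2 := nc mu (or_intror erefl) m1.
have h3 : D * cabs (P.[z] - P.[a]) <= D * (1 / 4 * cabs P.[a]).
  rewrite -cabsM.
  have -> : (lam - mu) * (P.[z] - P.[a]) = (Q.[z] - mu * P.[z] + mu * P.[a]) -
    (Q.[z] - lam * P.[z] + lam * P.[a]) by ring.
  by apply: le_trans (cabsB _ _) _; lra.
rewrite ler_pM2l // in h3.
(* As [D / 8 <= 1 / 4], [|Q(z)|] is at most [|P(a)| / 2], whereas [h3] keeps [|P(z)|] above three
   quarters of [|P(a)|]. *)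
have Qz : cabs Q.[z] <= 1 / 2 * cabs P.[a].
  have -> : Q.[z] = (Q.[z] - lam * P.[z] + lam * P.[a]) + lam * (P.[z] - P.[a]) by ring.
  apply: le_trans (cabsD _ _) _; rewrite cabsM l1 mul1r.
  have := ler_wpM2r (cabs_ge0 P.[a]) D2; lra.
have Pz := cabs_tri P.[z] P.[a] 0; rewrite !subr0 cabsBC in Pz.
have Pa0 : 0 < cabs P.[a].
  rewrite cabs_gt0; have := nz lam a (or_introl erefl).
  rewrite subrr cabs0 => /(_ rho0).
  by rewrite !hornerE Qa sub0r oppr_eq0 mulf_eq0 negb_or => /andP[].
rewrite PQ // in Qz; have : cabs P.[a] <= 0 by lra.
by rewrite leNgt Pa0.
Qed.

(** Put [D = |lam - mu|]. Within [D / (2 ^+ m * 4) * rho] of [z], [P] and [Q] each vary by at most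
    [D / 4 * |P(z)|], but passing from level [lam] to level [mu] takes a total variation of at least
    [D * |P(z)|]. *)
Lemma level_separation m P Q z z' lam mu (rho : R) :
  (size P <= m.+1)%N -> (size Q <= m.+1)%N -> 0 < rho ->
  (forall w, cabs (w - z) < rho -> P.[w] != 0) ->
  (forall w, cabs (w - z) < rho -> Q.[w] != 0) ->
  cabs lam = 1 -> cabs mu = 1 -> lam != mu ->
  Q.[z] = lam * P.[z] -> Q.[z'] = mu * P.[z'] ->
  cabs (lam - mu) / (2 ^+ m * 4) * rho < cabs (z' - z).
Proof.
move=> sP sQ rho0 Pn Qn l1 m1 lm Qz Qz'.
set D := cabs (lam - mu); have D0 : 0 < D by rewrite cabs_gt0 subr_eq0.
have D2 : D <= 2 := unimodular_dist l1 m1.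
have T1 : 1 <= 2 ^+ m :> R by rewrite exprn_ege1 // ler1n.
set T : R := 2 ^+ m in T1 *; have T0 : 0 < T by lra.
pose d := D / (T * 4).
have d0 : 0 < d by rewrite /d divr_gt0 // mulr_gt0.
have dT : d * T = D / 4 by rewrite /d; field; exact: lt0r_neq0.
have d1 : d <= 1.
  have : d * 1 <= d * T by rewrite ler_wpM2l // ltW.
  lra.
have d01 : 0 <= d <= 1 by rewrite (ltW d0).
rewrite ltNge -/d; apply/negP => zz.
have hP := near_const sP d01 Pn zz rho0; have hQ := near_const sQ d01 Qn zz rho0.
rewrite -/T dT in hP hQ.
have QP : cabs Q.[z] = cabs P.[z] by rewrite Qz cabsM l1 mul1r.
rewrite QP in hQ.
have P0 : 0 < cabs P.[z] by rewrite cabs_gt0 Pn // subrr cabs0.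
have E : (lam - mu) * P.[z] = mu * (P.[z'] - P.[z]) - (Q.[z'] - Q.[z]).
  by rewrite Qz Qz'; ring.
have : D * cabs P.[z] <= cabs (P.[z'] - P.[z]) + cabs (Q.[z'] - Q.[z]).
  rewrite /D -cabsM E; apply: le_trans (cabsB _ _) _.
  by rewrite cabsM m1 mul1r.
move=> h; have : D * cabs P.[z] <= 0 by lra.
by rewrite leNgt mulr_gt0.
Qed.
End OneFiber.

(** * Level points against zeros, at the scale [|1 - zeta| ^+ K] *)

Section LevelCurves.
Variable R : realType.
Local Notation C := (CC R).
Implicit Types (p : {poly {poly C}}) (a z w lam mu zeta : C).

Definition zeros_inside p (K : nat) (c : R) : Prop :=
  forall z zeta, cabs zeta = 1 -> zeta != 1 ->
    cabs (1 - zeta) < c -> cabs (1 - z) < c -> (reflection p).[z, zeta] = 0 ->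
    c * cabs (1 - zeta) ^+ K <= 1 - cabs z.

(** A zero branch tending to 1, which the arbitrary [d] expresses. Together with [zeros_inside], its
    distance to the circle is comparable to [|1 - zeta| ^+ K]. *)
Definition deep_branch p (K : nat) (psi : C -> C) (c : R) : Prop :=
  forall d : R, 0 < d -> exists2 e : R, 0 < e & forall zeta, cabs zeta = 1 ->
    cabs (1 - zeta) < e -> [/\ (reflection p).[psi zeta, zeta] = 0,
      cabs (1 - psi zeta) < d & 1 - cabs (psi zeta) <= c * cabs (1 - zeta) ^+ K].

Definition level_near p (psi : C -> C) K lam (M : R) zeta : Prop :=
  exists2 z, cabs (z - psi zeta) <= M * cabs (1 - zeta) ^+ K &
    (reflection p).[z, zeta] = lam * p.[z, zeta].

Lemma level_near_mono p psi K lam (M M' : R) zeta : M <= M' ->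
  level_near p psi K lam M zeta -> level_near p psi K lam M' zeta.
Proof.
move=> MM [z zM lz]; exists z => //; apply: le_trans zM _.
by rewrite ler_wpM2r // exprn_ge0 // cabs_ge0.
Qed.

Lemma deep_branch_inside p K psi (c c2 : R) : 0 < c <= 1 / 2 ->
  zeros_inside p K c -> deep_branch p K psi c2 ->
  exists2 e : R, 0 < e & forall zeta, cabs zeta = 1 -> zeta != 1 ->
    cabs (1 - zeta) < e -> 0 < cabs (psi zeta) < 1.
Proof.
move=> /andP[c0 c1] zi /(_ c c0)[e e0 h]; exists (Num.min c e).
  by rewrite lt_min c0.
move=> zeta z1 zn1; rewrite lt_min => /andP[zc ze].
have [Qa ac _] := h zeta z1 ze.
have := zi _ _ z1 zn1 zc ac Qa.
have : 0 < c * cabs (1 - zeta) ^+ K.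
  by rewrite mulr_gt0 // exprn_gt0 // cabs_gt0 subr_eq0 eq_sym.
have := cabs_tri (psi zeta) 1 0; rewrite !subr0 cabs1.
by move=> h1 h2 h3; apply/andP; split; lra.
Qed.

Lemma level_near_dichotomy p K psi (c c2 : R) lam mu : p != 0 -> 0 < c <= 1 / 2 ->
  zeros_inside p K c -> 0 < c2 -> deep_branch p K psi c2 ->
  cabs lam = 1 -> cabs mu = 1 -> lam != mu ->
  exists (M e : R), [/\ 0 <= M, 0 < e & forall zeta, cabs zeta = 1 -> zeta != 1 ->
    cabs (1 - zeta) < e ->
    level_near p psi K lam M zeta \/ level_near p psi K mu M zeta].
Proof.
move=> p0 c01 zi c20 db l1 m1 lm.
have [e1 e10 h1] := deep_branch_inside c01 zi db.
have [e2 e20 h2] := db 1 ltr01.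
pose M0 := 2 ^+ deg1 p * 8 / cabs (lam - mu).
have M00 : 0 <= M0 by rewrite divr_ge0 ?mulr_ge0 ?exprn_ge0 // cabs_ge0.
exists (M0 * c2), (Num.min e1 e2); split.
- by rewrite mulr_ge0 // ltW.
- by rewrite lt_min e10.
move=> zeta z1 zn1; rewrite lt_min => /andP[ze1 ze2].
have [Qa _ ac] := h2 zeta z1 ze2.
rewrite -horner_fiber in Qa.
have [z zM lz] := level_hit (size_fiber p zeta) (size_fiber_reflection p zeta)
  (fun w => fiber_reflection_circle p0 z1) Qa (h1 zeta z1 zn1 ze1) l1 m1 lm.
have zM' : cabs (z - psi zeta) <= M0 * c2 * cabs (1 - zeta) ^+ K.
  by apply: le_trans zM _; rewrite -/M0 -mulrA ler_wpM2l.
by rewrite !horner_fiber in lz; case: lz => lz; [left|right]; exists z.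
Qed.

(** Points of the level curve [f] are unimodular, and around them both slices are zero-free on a
    radius proportional to [|1 - zeta| ^+ K]; [level_separation] then keeps the curve [g] away. *)
Lemma level_branch_separation p K psi0 (c c2 : R) lam mu (f g : C -> C) :
  (forall u : C * C, bidisk u -> p.[u.1, u.2] != 0) -> p != 0 -> 0 < c <= 1 / 2 ->
  zeros_inside p K c -> deep_branch p K psi0 c2 ->
  cabs lam = 1 -> cabs mu = 1 -> lam != mu ->
  (forall d : R, 0 < d -> exists2 e, 0 < e & forall zeta, cabs (1 - zeta) < e ->
    cabs (1 - f zeta) < d /\ (reflection p).[f zeta, zeta] = lam * p.[f zeta, zeta]) ->
  (exists2 e : R, 0 < e & forall zeta, cabs (1 - zeta) < e ->
    (reflection p).[g zeta, zeta] = mu * p.[g zeta, zeta]) ->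
  exists (c' e : R), [/\ 0 < c', 0 < e & forall zeta, cabs zeta = 1 -> zeta != 1 ->
    cabs (1 - zeta) < e -> c' * cabs (1 - zeta) ^+ K <= cabs (f zeta - g zeta)].
Proof.
move=> nz p0 c01 zi db l1 m1 lm hf [e3 e30 hg].
have [e1 e10 ha] := deep_branch_inside c01 zi db.
have [e4 e40 hq] := db 1 ltr01.
move: c01 => /andP[c0 c1].
have c4 : 0 < c / 4 by rewrite divr_gt0.
have [e2 e20 {}hf] := hf _ c4.
set D := cabs (lam - mu) / (2 ^+ deg1 p * 4).
have D0 : 0 < D by rewrite divr_gt0 ?mulr_gt0 ?exprn_gt0 // cabs_gt0 subr_eq0.
exists (D * (c / 4)), (Num.min (Num.min c e1) (Num.min (Num.min e2 e4) e3)); split.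
- exact: mulr_gt0.
- by rewrite !lt_min c0 e10 e20 e30 e40.
move=> zeta z1 zn1; rewrite !lt_min => /andP[/andP[zc ze1] /andP[/andP[ze2 ze4] ze3]].
have [fc lf] := hf zeta ze2; have lg := hg zeta ze3.
have a01 := ha zeta z1 zn1 ze1; have [Qa _ _] := hq zeta z1 ze4.
set X := cabs (1 - zeta) ^+ K.
have X0 : 0 < X by rewrite exprn_gt0 // cabs_gt0 subr_eq0 eq_sym.
have X1 : X <= 1 by rewrite exprn_ile1 ?cabs_ge0 //; lra.
have cX : c * X <= c by rewrite ler_piMr // ltW.
have cX0 : 0 < c * X by rewrite mulr_gt0.
have inside w : cabs (1 - w) < c -> (fiber (reflection p) zeta).[w] = 0 ->
    c * X <= 1 - cabs w.
  by rewrite horner_fiber; exact: zi.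
(* A zero of [Q] at 1 would lie on the circle; so [P(1) <> 0] too, as [fiber_hurwitz] requires. *)
have Q1 : (fiber (reflection p) zeta).[1] != 0.
  apply/eqP => Q1; have := inside 1; rewrite subrr cabs0 cabs1 subrr => /(_ c0 Q1).
  by rewrite leNgt cX0.
have P1 : (fiber p zeta).[1] != 0.
  by rewrite -cabs_eq0 -fiber_reflection_circle ?cabs1 // cabs_eq0.
have hur := fiber_hurwitz nz z1 P1.
set z := f zeta in fc lf *; set z' := g zeta in lg *.
rewrite -!horner_fiber in lf lg Qa.
have zn0 : z != 0.
  rewrite -cabs_gt0; have := cabs_tri z 1 0.
  rewrite !subr0 cabs1; lra.
have zu : cabs z = 1.
  apply: (unimodular_solution (size_fiber p zeta) _ hur Qa a01 zn0).
    by move=> w; exact: fiber_reflection.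
  by rewrite lf cabsM l1 mul1r.
have Qn w : cabs (w - z) < c / 4 * X -> (fiber (reflection p) zeta).[w] != 0.
  move=> wz; apply/eqP => Qw.
  have wc : cabs (1 - w) < c.
    apply: le_lt_trans (cabs_tri z 1 w) _; rewrite (cabsBC z w); lra.
  have := inside w wc Qw; have := cabs_tri w z 0; rewrite !subr0 zu cabsBC; lra.
(* A zero [w] of [P] reflects to a zero [v] of [Q], at most twice as far from the unimodular [z];
   the radius [c / 4 * X] leaves room for this factor. *)
have Pn w : cabs (w - z) < c / 4 * X -> (fiber p zeta).[w] != 0.
  move=> wz; apply/eqP => Pw.
  have w2 : 1 / 2 <= cabs w.
    have := cabs_tri w z 0; rewrite !subr0 zu cabsBC; lra.
  have w0 : w != 0 by rewrite -cabs_gt0; lra.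
  set v := (w^*)^-1.
  have v0 : v != 0 by rewrite invr_eq0 conjC_eq0.
  have Qv : (fiber (reflection p) zeta).[v] = 0.
    by apply/eqP; rewrite -cabs_eq0 fiber_reflection // conjVK Pw cabs0 mulr0.
  have vz : cabs (v - z) <= 2 * cabs (w - z).
    have wv : cabs w * cabs (v - z) = cabs (w - z).
      rewrite -(cabs_conj w) -cabsM mulrBr mulfV ?conjC_eq0 //.
      have -> : 1 - w^* * z = z * (z - w)^*.
        by rewrite rmorphB mulrBr mulCconj zu expr1n toC1 (mulrC z).
      by rewrite cabsM zu mul1r cabs_conj cabsBC.
    have := ler_wpM2r (cabs_ge0 (v - z)) w2; lra.
  have vc : cabs (1 - v) < c.
    apply: le_lt_trans (cabs_tri z 1 v) _; rewrite (cabsBC z v); lra.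
  have := inside v vc Qv; have := cabs_tri v z 0; rewrite !subr0 zu cabsBC; lra.
have := level_separation (size_fiber p zeta) (size_fiber_reflection p zeta)
  (mulr_gt0 c4 X0)  Pn Qn l1 m1 lm lf lg.
by move=> h; rewrite -mulrA (cabsBC z z'); exact: ltW h.
Qed.
End LevelCurves.

(** * Level branches near the deepest zero branch, and the conclusion *)

Section Assembly.
Variable R : realType.
Local Notation C := (CC R).
Implicit Types (p : {poly {poly C}}) (a z w lam mu zeta : C).

Lemma level_branch_on_level p lam L (psi : 'I_L -> C -> C) (j : 'I_L) :
  level_branches p lam psi -> forall d : R, 0 < d ->
  exists2 e, 0 < e & forall zeta, cabs (1 - zeta) < e ->
    cabs (1 - psi j zeta) < d /\
    (reflection p).[psi j zeta, zeta] = lam * p.[psi j zeta, zeta].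
Proof.
move=> [/(_ j)[/analytic_expands[a [r fa]] f1] [line /near2P[e1 e10 h]]] d d0.
have de : 0 < Num.min d e1 by rewrite lt_min d0.
have [e2 e20 h2] := expands_continuous fa de.
exists (Num.min e1 e2); first by rewrite lt_min e10.
move=> zeta; rewrite lt_min => /andP[z1 /h2]; rewrite f1 lt_min => /andP[fd fe].
by split=> //; apply/(h _ _ fe z1); left; exists j.
Qed.

(** Because [K > 0], level points this close to the deep branch tend to [(1, 1)], so they lie on
    level branches; [zeta <> 1] excludes the line [z_2 = 1]. *)
Lemma level_near_branch p K psi0 (c : R) lam L (psi : 'I_L -> C -> C) (M : R) :
  (0 < K)%N -> 0 <= M -> deep_branch p K psi0 c -> level_branches p lam psi ->
  exists2 e, 0 < e & forall zeta, cabs zeta = 1 -> zeta != 1 ->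
    cabs (1 - zeta) < e -> level_near p psi0 K lam M zeta ->
    exists j, cabs (psi j zeta - psi0 zeta) <= M * cabs (1 - zeta) ^+ K.
Proof.
move=> K0 M0 db [_ [line /near2P[e1 e10 h]]].
have e12 : 0 < e1 / 2 by rewrite divr_gt0.
have [e2 e20 h2] := db _ e12.
have M1 : 0 < M + 1 by rewrite ltr_wpDl.
exists (Num.min (Num.min 1 e1) (Num.min e2 (e1 / 2 / (M + 1)))).
  by rewrite !lt_min ltr01 e10 e20 divr_gt0.
move=> zeta z1 zn1; rewrite !lt_min => /andP[/andP[zl1 ze1] /andP[ze2]].
rewrite ltr_pdivlMr // => zM [z zz lz].
have [_ ac _] := h2 zeta z1 ze2.
have XK : cabs (1 - zeta) ^+ K <= cabs (1 - zeta).
  case: K K0 {db zz h2} => // K _; rewrite exprS ler_piMr ?cabs_ge0 //.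
  by rewrite exprn_ile1 ?cabs_ge0 // ltW.
have zc : cabs (1 - z) < e1.
  apply: le_lt_trans (cabs_tri (psi0 zeta) 1 z) _; rewrite (cabsBC (psi0 zeta)).
  have := ler_wpM2l M0 XK; have := cabs_ge0 (1 - zeta); lra.
have /(h z zeta zc ze1)[[j /= zE]|[_ /= zeta1]] : level_set p lam (z, zeta) by [].
  by exists j; rewrite -zE.
by rewrite zeta1 eqxx in zn1.
Qed.

(** Pigeonhole: if each of the finitely many pairs were far apart near 1, a common threshold would
    contradict the points where both levels are near [psi0]. *)
Lemma frequent_contact p K psi0 (c : R) lam mu L L'
    (psi : 'I_L -> C -> C) (psi' : 'I_L' -> C -> C) (M : R) :
  (0 < K)%N -> 0 <= M -> deep_branch p K psi0 c ->
  level_branches p lam psi -> level_branches p mu psi' ->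
  (forall e : R, 0 < e -> exists zeta, [/\ cabs zeta = 1, zeta != 1,
     cabs (1 - zeta) < e, level_near p psi0 K lam M zeta &
     level_near p psi0 K mu M zeta]) ->
  exists i j, forall e : R, 0 < e -> exists zeta, [/\ zeta != 1,
    cabs (1 - zeta) < e &
    cabs (psi i zeta - psi' j zeta) <= 2 * M * cabs (1 - zeta) ^+ K].
Proof.
move=> K0 M0 db lb lb' fr.
have [e1 e10 h1] := level_near_branch K0 M0 db lb.
have [e2 e20 h2] := level_near_branch K0 M0 db lb'.
apply: contrapT => no.
pose far (ij : 'I_L * 'I_L') (e : R) := forall zeta, zeta != 1 ->
  cabs (1 - zeta) < e ->
  2 * M * cabs (1 - zeta) ^+ K < cabs (psi ij.1 zeta - psi' ij.2 zeta).
have [e e0 he] : exists2 e, 0 < e & forall ij, far ij e.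
  apply: uniform_threshold => [ij x y /andP[_ xy] h zeta z1 zx|[i j]].
    by apply: h => //; exact: lt_le_trans zx xy.
  apply: contrapT => no'; apply: no; exists i, j => e e0.
  apply: contrapT => no; apply: no'; exists e => // zeta z1 ze.
  by rewrite ltNge; apply/negP => zz; apply: no; exists zeta.
have ee : 0 < Num.min e (Num.min e1 e2) by rewrite !lt_min e0 e10.
have [zeta [z1 zn1]] := fr _ ee; rewrite !lt_min => /and3P[ze ze1 ze2] n1 n2.
have [i hi] := h1 zeta z1 zn1 ze1 n1; have [j hj] := h2 zeta z1 zn1 ze2 n2.
have := he (i, j) zeta zn1 ze; apply/negP; rewrite -leNgt /=.
apply: le_trans (cabs_tri (psi0 zeta) _ _) _; rewrite (cabsBC (psi0 zeta)); lra.
Qed.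

(* The exceptional value is a level that, however large M, stays M times farther
   from the deepest zero branch than the branch is from the circle, for points
   zeta arbitrarily close to 1; by the dichotomy every other level is then close
   to that branch at these same points. *)
Lemma exceptional_level p K psi0 (c c2 : R) : p != 0 -> 0 < c <= 1 / 2 ->
  zeros_inside p K c -> 0 < c2 -> deep_branch p K psi0 c2 ->
  exists2 mu0 : C, cabs mu0 = 1 & forall lam mu, cabs lam = 1 -> cabs mu = 1 ->
    lam != mu0 -> mu != mu0 ->
    exists2 M : R, 0 <= M & forall e : R, 0 < e -> exists zeta, [/\ cabs zeta = 1,
      zeta != 1, cabs (1 - zeta) < e, level_near p psi0 K lam M zeta &
      level_near p psi0 K mu M zeta].
Proof.
move=> p0 c01 zi c20 db.
have [[lam0 l01 miss]|nomiss] := pselect (exists2 lam0, cabs lam0 = 1 &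
    forall M e : R, 0 <= M -> 0 < e -> exists zeta, [/\ cabs zeta = 1, zeta != 1,
      cabs (1 - zeta) < e & ~ level_near p psi0 K lam0 M zeta]).
  exists lam0 => // lam mu l1 m1 ll ml.
  have [M1 [e1 [M10 e10 h1]]] := level_near_dichotomy p0 c01 zi c20 db l1 l01 ll.
  have [M2 [e2 [M20 e20 h2]]] := level_near_dichotomy p0 c01 zi c20 db m1 l01 ml.
  have M1M : M1 <= Num.max M1 M2 by rewrite le_max lexx.
  have M2M : M2 <= Num.max M1 M2 by rewrite le_max lexx orbT.
  have M0 := le_trans M10 M1M.
  exists (Num.max M1 M2) => // e e0.
  have ee : 0 < Num.min e (Num.min e1 e2) by rewrite !lt_min e0 e10.
  (* At a point missed by [lam0], the dichotomies of [lam0] with [lam] and with [mu] both select the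
     other level, at the same [zeta]. *)
  have [zeta [z1 zn1 + nl]] := miss _ _ M0 ee.
  rewrite !lt_min => /and3P[ze ze1 ze2]; exists zeta; split=> //.
    case: (h1 zeta z1 zn1 ze1) => /(level_near_mono _); first exact.
    by move=> /(_ _ M1M).
  case: (h2 zeta z1 zn1 ze2) => /(level_near_mono _); first exact.
  by move=> /(_ _ M2M).
have hit lam : cabs lam = 1 -> exists (M e : R), [/\ 0 <= M, 0 < e &
    forall zeta, cabs zeta = 1 -> zeta != 1 -> cabs (1 - zeta) < e ->
    level_near p psi0 K lam M zeta].
  move=> l1; apply: contrapT => no; apply: nomiss; exists lam => // M e M0 e0.
  apply: contrapT => no'; apply: no; exists M, e; split=> // zeta z1 zn1 ze.
  by apply: contrapT => nl; apply: no'; exists zeta.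
(* Every level stays near the branch, so no value is exceptional and 1 is an arbitrary choice. *)
exists 1; first exact: cabs1.
move=> lam mu /hit[M1 [e1 [M10 e10 h1]]] /hit[M2 [e2 [M20 e20 h2]]] _ _.
have M1M : M1 <= Num.max M1 M2 by rewrite le_max lexx.
have M2M : M2 <= Num.max M1 M2 by rewrite le_max lexx orbT.
exists (Num.max M1 M2) => [|e e0]; first exact: le_trans M1M.
have ee : 0 < Num.min e (Num.min e1 e2) by rewrite !lt_min e0 e10.
have [zeta [z1 zn1]] := circle_point_near1 ee.
rewrite !lt_min => /and3P[ze ze1 ze2]; exists zeta; split=> //.
  exact: level_near_mono M1M (h1 _ z1 zn1 ze1).
exact: level_near_mono M2M (h2 _ z1 zn1 ze2).
Qed.
End Assembly.

Theorem theorem3p1 (R : realType) (p : {poly {poly CC R}}) (hp : A1 p)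
    (K : nat) (hK : z1_contact_order p K) :
  exists mu0 : CC R, `|mu0| = 1 /\
    forall lam mu : CC R, `|lam| = 1 -> `|mu| = 1 -> lam <> mu ->
      lam <> mu0 -> mu <> mu0 ->
      forall (L L' : nat) (psi : 'I_L -> CC R -> CC R)
             (psi' : 'I_L' -> CC R -> CC R),
        level_branches p lam psi -> level_branches p mu psi' ->
        z1_order_of_contact psi psi' K.
Proof.
have [nz _ _ p11 _] := hp.
have p0 : p != 0.
  have := nz (0, 0); rewrite /bidisk /= normr0 ltr01 => /(_ (conj isT isT)).
  by apply: contraNneq => ->; rewrite !horner0.
have [c c01 zi] := z1_contact_order_lower hK.
have [K0 [psi0 [c2 [c20 db]]]] := z1_contact_order_branch p0 p11 hK.
have [mu0 m01 close] := exceptional_level p0 c01 zi c20 db.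
exists mu0; split=> [|lam mu /normE1 l1 /normE1 m1 /eqP lm /eqP lm0 /eqP mm0];
  first exact/normE1.
move=> L L' psi psi' lb lb'.
(* Separation makes any two level branches differ in a coefficient of index at most [K]. *)
have sep i j : exists a b (r r' : R) n, [/\ expands (psi i) 1 a r,
    expands (psi' j) 1 b r', (n <= K)%N, order_of_contact (psi i) (psi' j) 1 n &
    (forall k, (k < n)%N -> a k = b k) /\ a n != b n].
  have [[/analytic_expands[a [r fa]] f1] [/analytic_expands[b [r' gb]] g1]] :=
    (lb.1 i, lb'.1 j).
  have [|c' [e [c'0 e0 low]]] := level_branch_separation nz p0 c01 zi db l1 m1 lm
    (level_branch_on_level i lb) (g := psi' j).
    have [e e0 h] := level_branch_on_level j lb' ltr01.
    by exists e => // zeta /h[].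
  have fg : psi i 1 = psi' j 1 by rewrite f1 g1.
  have [n [nK ord eqk neqn]] := expands_order_of_contact fa gb fg
    (contact_le fa gb c'0 e0 low).
  by exists a, b, r, r', n.
split=> [|i j]; last by have [a [b [r [r' [n [_ _ nK ord _]]]]]] := sep i j; exists n.
(* A pair that is close at points tending to 1 has order at least [K], so [K] is attained. *)
have [M M0 fr] := close lam mu l1 m1 lm0 mm0.
have [i [j cl]] := frequent_contact K0 M0 db lb lb' fr.
exists i, j; have [a [b [r [r' [n [fa gb nK ord [eqk neqn]]]]]]] := sep i j.
have MM : 0 <= 2 * M by rewrite mulr_ge0.
have Kn := contact_ge fa gb MM cl eqk neqn.
by have -> : K = n by apply/eqP; rewrite eqn_leq Kn nK.
Qed.
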